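(* In the setting of the context (random unimodal map with heteroscedastic dynamical noise; observed process $Z_n$ with constant modulation $s\equiv1$ and non-atomic observational noise law $\psi$; observable $\phi$ and thresholds $u_n$ such that the sets $B_n=\{\phi>u_n\}$ have diameter tending to $0$; and $n\Delta_n\to\tau$ for some $\tau>0$, where $\Delta_n=\int\psi(B_n-x)\,d\mu(x)$), one has $$W_n=\mathfrak P\Big(\max_{0\le j\le n-1}\phi(Z_j)\le u_n\Big)\longrightarrow e^{-\tau},\qquad n\to\infty.$$
   Context: Map and dynamical noise (Assumption TM). $T$ is a continuous unimodal map on $[0,1]$ with a unique maximum at a point $\mathfrak c$, and $\Upsilon:=T(\mathfrak c)<1$; there is a closed interval $[d_1,d_2]\subset[0,1]$, forward invariant under $T$, on which all powers $T^n$, $n\ge1$, are topologically transitive; $T$ preserves a unique absolutely continuous Borel probability measure. Put $\Gamma=1-\Upsilon$, $q=T(0)$ and $I=[-\Gamma,1]$. $T$ is extended to $I$ so that on $[-\Gamma,0]$ it is $C^4$ and decreasing with $T(-\Gamma)<\Upsilon$. $\sigma:\mathbb R\to[0,\infty)$ is differentiable, $\sigma_{\max}=\max_{x\in I}\sigma(x)$, and $a>0$ satisfies $a\le\frac1{\sigma_{\max}}\min\{\frac\Gamma2,\frac q2,\frac12T(1-\frac\Gamma2)\}$. The noises $\eta_0,\eta_1,\dots$ are i.i.d. real random variables with density $g(x)=c_a\chi_a(x)e^{-x^2/2}$, where $\chi_a$ is a $C^\infty$ bump function supported in $[-a,a]$ and $c_a$ is the normalizing constant. Set $T_\eta(x)=T(x)+\sigma(x)\eta$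 and, for $\underline\eta=(\eta_0,\eta_1,\dots)$, $T^n_{\underline\eta}=T_{\eta_{n-1}}\circ\cdots\circ T_{\eta_0}$, $T^0_{\underline\eta}=\mathrm{id}$. The Markov kernel is $p(x,z)=\frac1{\sigma(x)}g\big(\frac{z-T(x)}{\sigma(x)}\big)$ and the Markov operator is $\mathcal Lf(z)=\int f(x)p(x,z)\,dx$. $\mathcal B$ is the space of functions of bounded variation on $I$ with norm $\|f\|_{\mathcal B}=\mathrm{Var}(f)+\|f\|_{L^1}$. Standing facts of the setting: random orbits stay in $[-\Gamma/2,1-\Gamma/2]$; there is a unique absolutely continuous stationary probability measure $\mu$, with density $h$ ($\mathcal Lh=h$) supported in $I_\Gamma=[\frac12T(1-\frac\Gamma2),1-\frac\Gamma2]$; $p$ is uniformly bounded and $\operatorname{ess\,sup}_x\mathrm{Var}(p(x,\cdot))<\infty$, so $\mathcal L$ is compact on $\mathcal B$; $1$ is a simple eigenvalue of $\mathcal L$ and $\mathcal L$ has a spectral gap. Observational noise (Assumption EI). The modulation is $s\equiv1$; $(\epsilon_k)_{k\ge0}$ are i.i.d. with non-atomic law $\psi$, independent of the $\eta_k$ and of the initial point, and bounded by a constant smaller than $\Gamma/2$ in absolute value. $\mathfrak P$ is the product of $\mu$ (law of the initial point $x$), the law of $\underline\eta$ and the law of $(\epsilon_k)$. The observed process is $Z_n=T^n_{\underline\eta}(x)+\epsilon_n\in I$. Notation: $\psi(B-x)=\psi(\{\epsilon: x+\epsilon\in B\})$. Extremes. $\phi:I\to\mathbb R\cup\{\pm\infty\}$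 is measurable, $(u_n)$ is a real sequence, $B_n=\{\phi>u_n\}$ and the diameter of $B_n$ tends to $0$ as $n\to\infty$ (Assumption B). It is also required that $h$ is bounded below by a positive constant (independent of $n$) on the set $\{x:x+\epsilon\in B_n\text{ for some }\epsilon\in\mathrm{supp}\,\psi\}$. *)

(* Defs.v *)
From HB Require Import structures.
From mathcomp Require Import all_boot all_order all_algebra.
From mathcomp Require Import all_classical all_reals all_analysis.
From mathcomp Require Import measurable_realfun ess_sup_inf.
Set Implicit Arguments.
Unset Strict Implicit.
Unset Printing Implicit Defensive.
Import Order.TTheory GRing.Theory Num.Theory.
Import numFieldNormedType.Exports.
Local Open Scope classical_set_scope.
Local Open Scope ring_scope.

(* Maps of the phase space I = [-Gamma, 1] are total
   functions R -> R (R -> \bar R for the observable); except for Borel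
   measurability, only their values on I are constrained. *)

Section GeneralNotions.
Context {R : realType}.
Local Notation leb := (@lebesgue_measure R).
Implicit Types (f : R -> R) (A B J : set R) (nu : probability (measurableTypeR R) R).

Definition C_k (k : nat) f :=
  (forall j x, (j < k)%N -> derivable (derive1n j f) x 1) /\ continuous (derive1n k f).

Definition C_infty f := forall k, C_k k f.

(* C^k up to the endpoints of a closed interval. *)
Definition C_k_on (k : nat) A f :=
  exists2 F : R -> R, C_k k F & {in A, F =1 f}.

Definition topologically_transitive J f :=
  forall U V : set R, open U -> open V -> U `&` J !=set0 -> V `&` J !=set0 ->
  exists2 k : nat, (0 < k)%N & (iter k f @` (U `&` J)) `&` V !=set0.

Definition diam B : R := sup [set `|x.1 - x.2| | x in B `*` B].

Definition msupport nu : set R :=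
  [set x | forall U, open U -> U x -> (0 < nu U)%E].

Definition non_atomic nu := forall x : R, nu [set x] = 0%E.

End GeneralNotions.

Definition mutually_independent d (Om : measurableType d) (R : realType)
    (P : probability Om R) (K : eqType) (X : K -> {RV P >-> R}) :=
  forall (s : seq K) (A : K -> set R), uniq s -> (forall k, measurable (A k)) ->
  P (\bigcap_(k in [set` s]) X k @^-1` A k)
    = (\prod_(k <- s) P (X k @^-1` A k))%E.

Definition has_law d (Om : measurableType d) (R : realType)
    (P : probability Om R) (X : {RV P >-> R}) (nu : set R -> \bar R) :=
  forall A : set R, measurable A -> distribution P X A = nu A.

Record system (R : realType) := System {
  smap : R -> R;    (* T *)
  crit : R;         (* location of the maximum *)
  d1 : R;
  d2 : R;
  sigma : R -> R;
  amp : R;          (* a *)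
  chi : R -> R     (* smooth bump function *)
}.

Section System.
Context {R : realType} (S : system R).
Local Notation leb := (@lebesgue_measure R).
Local Notation T := (smap S).
Local Notation sigma := (sigma S).
Local Notation c := (crit S).
Local Notation a := (amp S).
Implicit Types (f h : R -> R) (nu mu : probability (measurableTypeR R) R).

Definition Upsilon : R := T c.
Definition Gamma : R := 1 - Upsilon.
Definition phase_space : set R := `[- Gamma, 1].
Definition sigma_max : R := sup (sigma @` phase_space).
Definition I_Gamma : set R := `[T (1 - Gamma / 2) / 2, 1 - Gamma / 2].

Definition gauss_bump (x : R) : R := chi S x * expR (- (x ^+ 2 / 2)).
Definition norm_const : R := (\int[leb]_x gauss_bump x)^-1.
Definition noise_density (x : R) : R := norm_const * gauss_bump x.

Definition noise_law (A : set R) : \bar R := (\int[leb]_(y in A) (noise_density y)%:E)%E.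

Definition T_noise (eta x : R) : R := T x + sigma x * eta.

Fixpoint orbit (eta : nat -> R) (n : nat) (x : R) : R :=
  if n is m.+1 then T_noise (eta m) (orbit eta m x) else x.

Definition kernel_p (x z : R) : R := (sigma x)^-1 * noise_density ((z - T x) / sigma x).

Definition markov_op f (z : R) : R := \int[leb]_(x in phase_space) (f x * kernel_p x z).

Definition BV f := bounded_variation (- Gamma) 1 f.

Definition bv_norm f : \bar R :=
  (total_variation (- Gamma) 1 f + \int[leb]_(x in phase_space) (`|f x|)%:E)%E.

Definition acim nu :=
  [/\ nu `[0, 1]%classic = 1%E, nu `<< leb &
      forall A, measurable A -> nu (`[0, 1]%classic `&` T @^-1` A) = nu A].

Record assumption_TM : Prop := {
  (* normalisation of the total extension of T off the phase space *)
  tm_meas : measurable_fun setT T;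
  tm_cont : {within `[0, 1], continuous T};
  tm_map : forall x, x \in `[0, 1] -> T x \in `[0, 1];
  tm_crit : 0 < c < 1;
  tm_incr : {in `[0, c] &, {homo T : x y / x <= y}};
  tm_decr : {in `[c, 1] &, {homo T : x y /~ x <= y}};
  tm_max : forall x, x \in `[0, 1] -> x != c -> T x < T c;
  tm_Upsilon : Upsilon < 1;
  tm_interval : [/\ 0 <= d1 S, d1 S < d2 S & d2 S <= 1];
  tm_forward : forall x, x \in `[d1 S, d2 S] -> T x \in `[d1 S, d2 S];
  tm_transitive : forall n, (0 < n)%N ->
    topologically_transitive `[d1 S, d2 S] (iter n T);
  tm_acim : exists2 nu, acim nu &
    forall nu', acim nu' -> forall A, measurable A -> nu' A = nu A;
  tm_ext_C4 : C_k_on 4 `[- Gamma, 0] T;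
  tm_ext_decr : {in `[- Gamma, 0] &, {homo T : x y /~ x <= y}};
  tm_ext_lt : T (- Gamma) < Upsilon;
  tm_sigma_ge0 : forall x, 0 <= sigma x;
  tm_sigma_diff : forall x, derivable sigma x 1;
  tm_a_gt0 : 0 < a;
  tm_a_le : a <= sigma_max^-1 *
    Num.min (Gamma / 2) (Num.min (T 0 / 2) (T (1 - Gamma / 2) / 2));
  tm_bump_smooth : C_infty (chi S);
  tm_bump_ge0 : forall x, 0 <= chi S x;
  tm_bump_supp : forall x, chi S x != 0 -> x \in `[- a, a]
}.

(* nu A = \int Prob(T_eta x \in A) dnu(x), with eta distributed as noise_law *)
Definition stationary nu := forall A, measurable A ->
  nu A = (\int[nu]_x noise_law [set y | T_noise y x \in A])%E.

Definition ac_stationary nu :=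
  [/\ nu phase_space = 1%E, nu `<< leb & stationary nu].

(* h spans the generalised eigenspace of the eigenvalue 1 of L on BV. *)
Definition simple_eigenvalue1 h :=
  [/\ BV h,
      exists2 x, x \in phase_space & h x != 0,
      {in phase_space, markov_op h =1 h} &
      forall f (k : nat), BV f ->
        {in phase_space, iter k (fun u x => markov_op u x - u x) f =1 cst 0} ->
        exists b : R, {in phase_space, f =1 (fun x => b * h x)}].

Definition residual_op h (l : (R -> R) -> R) f (x : R) : R :=
  markov_op f x - l f * h x.

(* L = Pi + Q, where Pi f = l(f) h is the bounded rank-one projection onto the
   eigenspace of 1, Pi commutes with L (so that Pi Q = Q Pi = 0), and Q has
   spectral radius < 1, in Gelfand's form |Q^n| <= C rho^n with rho < 1. *)
Definition spectral_gap h :=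
  exists l : (R -> R) -> R,
  [/\ forall (b : R) f1 f2, BV f1 -> BV f2 ->
        l (fun x => b * f1 x + f2 x) = b * l f1 + l f2,
      exists M : R, forall f, BV f -> ((`|l f|)%:E <= M%:E * bv_norm f)%E,
      l h = 1,
      forall f, BV f -> l (markov_op f) = l f &
      exists C rho : R, [/\ 0 <= rho, rho < 1 &
        forall f (n : nat), BV f ->
          (bv_norm (iter n (residual_op h l) f)
             <= (C * rho ^+ n)%:E * bv_norm f)%E]].

Record standing_facts mu h : Prop := {
  sf_stationary : ac_stationary mu;
  sf_unique : forall nu, ac_stationary nu ->
    forall A, measurable A -> nu A = mu A;
  sf_meas : measurable_fun setT h;
  sf_ge0 : forall x, 0 <= h x;
  sf_density : forall A, measurable A ->
    mu A = (\int[leb]_(x in A) (h x)%:E)%E;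
  sf_support : forall x, h x != 0 -> x \in I_Gamma;
  sf_p_bounded : exists M : R,
    forall x z, x \in phase_space -> z \in phase_space -> kernel_p x z <= M;
  sf_p_var : (ess_sup leb
    ((fun x => total_variation (- Gamma) 1 (kernel_p x)) \_ phase_space) < +oo)%E;
  sf_simple : simple_eigenvalue1 h;
  sf_gap : spectral_gap h
}.

Record assumption_EI (psi : probability (measurableTypeR R) R) : Prop := {
  ei_non_atomic : non_atomic psi;
  ei_bounded : exists2 b : R, b < Gamma / 2 & psi [set e | `|e| <= b] = 1%E
}.

Section RandomOrbit.
Context {d : measure_display} {Om : measurableType d} {P : probability Om R}.
Variables (X0 : {RV P >-> R}) (eta eps : nat -> {RV P >-> R}).

Definition all_variables (k : option (nat + nat)) : {RV P >-> R} :=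
  match k with
  | None => X0
  | Some (inl i) => eta i
  | Some (inr i) => eps i
  end.

(* P is the product of the law mu of the initial point, the law of the i.i.d.
   dynamical noise and the law of the i.i.d. observational noise. *)
Record product_setting mu (psi : probability (measurableTypeR R) R) : Prop := {
  ps_initial : has_law X0 mu;
  ps_eta : forall k, has_law (eta k) noise_law;
  ps_eps : forall k, has_law (eps k) psi;
  ps_indep : mutually_independent all_variables
}.

Definition observed (n : nat) (w : Om) : R :=
  orbit (fun k => eta k w) n (X0 w) + eps n w.

End RandomOrbit.

Section Extremes.
Variables (phi : R -> \bar R) (u : nat -> R).

Definition exceedance (n : nat) : set R :=
  phase_space `&` [set x | ((u n)%:E < phi x)%E].

Definition assumption_B :=
  measurable_fun setT phi /\ (fun n => diam (exceedance n)) @ \oo --> (0 : R).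

Definition density_bounded_below h (psi : probability (measurableTypeR R) R) :=
  exists2 kappa : R, 0 < kappa & forall (n : nat) x, x \in phase_space ->
    (exists2 e, msupport psi e & exceedance n (x + e)) -> kappa <= h x.

Definition Delta mu (psi : probability (measurableTypeR R) R) (n : nat) : \bar R :=
  (\int[mu]_x psi [set e : R | exceedance n (x + e)%R])%E.

Definition W {d : measure_display} {Om : measurableType d}
    (P : probability Om R) (Z : nat -> Om -> R) (n : nat) : \bar R :=
  P [set w | (\big[maxe/-oo]_(j < n) phi (Z j w) <= (u n)%:E)%E].

End Extremes.
End System.

(* Main.v *)
Require Import Defs.
From HB Require Import structures.
From mathcomp Require Import all_boot all_order all_algebra.
From mathcomp Require Import all_classical all_reals all_analysis.
From mathcomp Require Import measurable_realfun ess_sup_inf.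
From mathcomp Require Import ring lra.
Set Implicit Arguments.
Unset Strict Implicit.
Unset Printing Implicit Defensive.
Import Order.TTheory GRing.Theory Num.Theory.
Import numFieldNormedType.Exports.
Local Open Scope classical_set_scope.
Local Open Scope ring_scope.

(** Integrating out the observational noise turns the probability that the
    first n observations stay below the threshold into a survival probability
    for the random orbit itself: a visit to x is survived with probability
    [1 - f x], where [f x] is the probability that x plus the noise falls in
    the exceedance set.  As the n-th state has a density with respect to
    Lebesgue measure, the density of the state on the event of survival is
    obtained from h by iterating the open operator
    [q |-> L ((1 - f) q)], L being the Markov operator
    ([survives_probability]).

    The open operator differs from L by [q |-> L (f q)].  Since the kernel is
    bounded and of bounded variation in its second variable, this difference
    has BV norm at most a constant times the integral of [f q] ([markov_bv]).
    On surviving densities, which lie below h, this is at most a constant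
    times delta, the stationary mean of f.  The spectral gap makes such
    perturbations sum up geometrically instead of accumulating with time, so
    the surviving density is, uniformly on the phase space and in time,
    within a constant times delta of a multiple of h
    ([spectral_gap_perturbation]).

    Consequently the fraction of mass lost in one step is delta up to an
    error of order delta^2 ([survival_recursion]).  The factor that makes the
    error quadratic is the bound of the Lebesgue integral of f by
    delta / kappa, where kappa is the lower bound of h on the points from
    which the exceedance set can be observed.  After n steps the survival
    probability is exp (- n delta) up to an error of order n delta^2
    ([exponential_decay]), and n delta tends to tau.

    The observable enters only through [L (f q)], that is after one
    application of L has smoothed it; this is why integrals of f control BV
    norms. *)

(** * Perturbed geometric sequences *)

Lemma expRN_approx (R : realType) (x : R) : 0 <= x ->
  `|(1 - x) - expR (- x)| <= x ^+ 2.
Proof.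
move=> x0; have h1 : 1 - x <= expR (- x) by have := expR_ge1Dx (- x); lra.
have h2 : 1 + x <= expR x := expR_ge1Dx x.
have e0 : 0 < expR (- x) := expR_gt0 _.
have e1 : expR x * expR (- x) = 1 by rewrite -expRD subrr expR0.
have h3 : (1 + x) * expR (- x) <= 1 by rewrite -[leRHS]e1 ler_pM2r.
rewrite ler0_norm ?subr_le0//.
have : (1 + x) * (expR (- x) - (1 - x)) <= x ^+ 2 by nra.
have : 0 <= x * (expR (- x) - (1 - x)) by rewrite mulr_ge0// subr_ge0.
by nra.
Qed.

(** [1 - delta] and [expR (- delta)] differ by at most [delta ^+ 2], and a
    factor [expR (- delta)] does not amplify earlier errors, so the one-step
    errors add up. *)
Lemma exponential_decay (R : realType) (S : nat -> R) (delta K : R) :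
  0 <= delta -> S 0%N = 1 -> (forall k, `|S k| <= 1) ->
  (forall k, `|S k.+1 - (1 - delta) * S k| <= K * delta ^+ 2) ->
  forall n, `|S n - expR (- (n%:R * delta))| <= n%:R * ((K + 1) * delta ^+ 2).
Proof.
move=> d0 S0 S1 rec; elim=> [|n IH].
  by rewrite mul0r oppr0 expR0 S0 subrr normr0 mul0r.
have eE : expR (- (n.+1%:R * delta)) = expR (- delta) * expR (- (n%:R * delta)).
  by rewrite -expRD; congr expR; rewrite -natr1; ring.
have -> : S n.+1 - expR (- (n.+1%:R * delta)) =
    (S n.+1 - (1 - delta) * S n) + ((1 - delta) - expR (- delta)) * S n
    + expR (- delta) * (S n - expR (- (n%:R * delta))).
  by rewrite eE; ring.
have a1 := rec n; have a2 := expRN_approx d0; have a3 := S1 n.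
have e01 : expR (- delta) <= 1 by rewrite expR_le1 oppr_le0.
have b1 : `|expR (- delta) * (S n - expR (- (n%:R * delta)))| <=
    n%:R * ((K + 1) * delta ^+ 2).
  rewrite normrM ger0_norm ?expR_ge0//; apply: le_trans IH.
  by rewrite -[leRHS]mul1r ler_wpM2r.
have b2 : `|((1 - delta) - expR (- delta)) * S n| <= delta ^+ 2.
  rewrite normrM; apply: le_trans a2.
  by rewrite -[leRHS]mulr1 ler_wpM2l.
apply: (le_trans (ler_normD _ _)).
apply: (le_trans (lerD (ler_normD _ _) (lexx _))).
by rewrite -natr1; lra.
Qed.

Lemma cvg_exponential_law (R : realType) (delta w : nat -> R) (K tau : R) :
  (fun n => n%:R * delta n) @ \oo --> tau ->
  (forall n, `|w n - expR (- (n%:R * delta n))| <= n%:R * (K * delta n ^+ 2)) ->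
  w @ \oo --> expR (- tau).
Proof.
move=> cd wd.
have c1 : (fun n => expR (- (n%:R * delta n))) @ \oo --> expR (- tau).
  exact: (cvg_comp _ _ (cvgN cd) (@continuous_expR R (- tau))).
have c2 : delta @ \oo --> (0 : R).
  rewrite -cvg_shiftS /=.
  have -> : (fun n => delta n.+1) =
      (fun n => (n.+1%:R * delta n.+1) * harmonic n :> R).
    by apply/funext => n; rewrite /harmonic /= mulrAC mulfV ?mul1r ?pnatr_eq0.
  have cd' : (fun n => n.+1%:R * delta n.+1) @ \oo --> tau.
    by rewrite (cvg_shiftS (fun n => n%:R * delta n)).
  have := cvgM cd' (@cvg_harmonic R); rewrite mulr0; exact.
have c3 : (fun n => n%:R * (K * delta n ^+ 2)) @ \oo --> (0 : R).
  have -> : (fun n => n%:R * (K * delta n ^+ 2)) =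
      (fun n => (n%:R * delta n) * (K * delta n)).
    by apply/funext => n; ring.
  have cK : (fun n => K * delta n) @ \oo --> (0 : R).
    by have := cvgM (cvg_cst K) c2; rewrite mulr0; exact.
  have := cvgM cd cK; rewrite mulr0; exact.
have c4 : (fun n => w n - expR (- (n%:R * delta n))) @ \oo --> (0 : R).
  apply: norm_cvg0; apply: (squeeze_cvgr _ _ c3); last exact: cvg_cst.
  by apply: nearW => n /=; rewrite normr_ge0 wd.
have -> : w = (fun n => (w n - expR (- (n%:R * delta n))) +
                        expR (- (n%:R * delta n))).
  by apply/funext => n; rewrite subrK.
by rewrite -[expR _]add0r; exact: cvgD.
Qed.

(** * Measures given by densities *)

Section DensityMeasure.
Local Open Scope ereal_scope.
Context d (T : measurableType d) (R : realType) (mu : {measure set T -> \bar R}).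
Variable w : T -> \bar R.
Hypotheses (mw : measurable_fun setT w) (w0 : forall x, 0 <= w x).

(** The two proofs are arguments so that the measure instance below can be
    found from the term alone. *)
Definition weighted (_ : measurable_fun setT w) (_ : forall x, 0 <= w x)
  (A : set T) : \bar R := \int[mu]_(x in A) w x.

Local Notation nu := (weighted mw w0).

Let nu0 : nu set0 = 0. Proof. by rewrite /weighted integral_set0. Qed.

Let nu_ge0 A : 0 <= nu A. Proof. by apply: integral_ge0 => x _. Qed.

HB.instance Definition _ := isMeasure.Build _ _ _ nu nu0 nu_ge0
  (semi_sigma_additive_nng_induced mw w0).

End DensityMeasure.

Section RestrictedImage.
Local Open Scope ereal_scope.
Context d d' (T1 : measurableType d) (T2 : measurableType d') (R : realType).
Variables (P : {measure set T1 -> \bar R}) (Q : set T1) (f : T1 -> T2).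
Hypotheses (mQ : measurable Q) (mf : measurable_fun setT f).

(** The proofs are arguments for the same reason as in [weighted]. *)
Definition restricted_image (_ : measurable Q) (_ : measurable_fun setT f)
  (A : set T2) : \bar R := P (Q `&` f @^-1` A).

Local Notation nu := (restricted_image mQ mf).

Let nu0 : nu set0 = 0.
Proof. by rewrite /restricted_image preimage_set0 setI0 measure0. Qed.

Let nu_ge0 A : 0 <= nu A. Proof. exact: measure_ge0. Qed.

Let nu_sigma_additive : semi_sigma_additive nu.
Proof.
move=> F mF tF mUF; rewrite /restricted_image preimage_bigcup setI_bigcupr.
have mQF n : measurable (Q `&` f @^-1` F n).
  by apply: measurableI => //; rewrite -[X in measurable X]setTI; exact: mf.
apply: measure_semi_sigma_additive => //; last exact: bigcup_measurable.
apply/trivIsetP => i j _ _ ij; rewrite setIACA -[X in _ `&` X]preimage_setI.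
by move/trivIsetP : tF => /(_ _ _ _ _ ij) ->//; rewrite preimage_set0 setI0.
Qed.

HB.instance Definition _ := isMeasure.Build _ _ _ nu nu0 nu_ge0
  nu_sigma_additive.

End RestrictedImage.

(** Both sides are finite measures of D that agree on rectangles: the image of
    P restricted to Q, and the measure of density [w \o fst] with respect to the
    product of Lebesgue measure and lam. *)
Lemma joint_law_with_density d (Om : measurableType d) (R : realType)
    (P : {finite_measure set Om -> \bar R}) (Q : set Om) (X Y : Om -> R)
    (mQ : measurable Q) (mX : measurable_fun setT X) (mY : measurable_fun setT Y)
    (lam : probability (measurableTypeR R) R) (w : R -> \bar R)
    (mw : measurable_fun setT w) (w0 : forall x, (0 <= w x)%E) :
  (forall A B, measurable A -> measurable B ->
     P (Q `&` X @^-1` A `&` Y @^-1` B) =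
       (\int[lebesgue_measure]_(x in A) w x * lam B)%E) ->
  forall D : set (R * R), measurable D ->
    P (Q `&` [set o | D (X o, Y o)]) =
      (\int[lebesgue_measure]_x (w x * lam (xsection D x)))%E.
Proof.
move=> rect D mD.
have mXY : measurable_fun setT (fun o => (X o, Y o)) by exact: measurable_fun_pair.
pose leb := @lebesgue_measure R.
have mw2 : measurable_fun setT (w \o fst : R * R -> \bar R).
  exact: measurableT_comp.
have w20 (z : R * R) : (0 <= (w \o fst) z)%E by exact: w0.
pose m2 : {measure set (measurableTypeR R * measurableTypeR R) -> \bar R} :=
  weighted (leb \x lam)%E mw2 w20.
have fin1 : (P setT < +oo)%E by rewrite -ge0_fin_numE// fin_num_measure.
have m2E C : measurable C -> m2 C = (\int[leb]_x (w x * lam (xsection C x)))%E.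
  move=> mC; rewrite /m2 /= /weighted integral_mkcond.
  have mp : measurable_fun setT ((w \o fst) \_ C).
    by apply/(measurable_restrictT _ mC); exact: measurable_funTS.
  rewrite (fubini_tonelli1 ((w \o fst) \_ C))//; last first.
    by move=> x; apply: erestrict_ge0.
  apply: eq_integral => x _; rewrite /fubini_F.
  rewrite -[xsection C x]setIT -integral_indic//; last exact: measurable_xsection.
  rewrite -ge0_integralZl//.
  - apply: eq_integral => y _; rewrite /patch indicE mem_xsection /=.
    by case: ifP; rewrite ?mule1 ?mule0.
  - by apply/measurable_EFinP; apply: measurable_indic; exact: measurable_xsection.
have mXY' : @measurable_fun _ _ _ (measurableTypeR R * measurableTypeR R)%type
  setT (fun o => (X o, Y o)) by exact: mXY.
pose m1 : {measure set (measurableTypeR R * measurableTypeR R) -> \bar R} :=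
  restricted_image P mQ mXY'.
have m1E C : m1 C = P (Q `&` [set o | C (X o, Y o)]) by [].
rewrite -m1E -m2E//.
pose rects : set (set (measurableTypeR R * measurableTypeR R)) :=
  [set A `*` B | A in measurable & B in measurable].
apply: (measure_unique rects (fun=> setT)) => //.
- by rewrite measurable_prod_measurableType.
- move=> _ _ [A1 mA1 [B1 mB1 <-]] [A2 mA2 [B2 mB2 <-]].
  rewrite -setXI; exists (A1 `&` A2); first exact: measurableI.
  by exists (B1 `&` B2) => //; exact: measurableI.
- by move=> _; exists setT => //; exists setT => //; rewrite setXTT.
- by rewrite bigcup_const//; exists 0%N.
- move=> _ [A mA [B mB <-]]. rewrite m1E m2E; last exact: measurableX.
  have -> : Q `&` [set o | (A `*` B) (X o, Y o)] = Q `&` X @^-1` A `&` Y @^-1` B.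
    by rewrite -setIA; congr (_ `&` _).
  rewrite rect// -ge0_integralZr//; last by apply: measurable_funTS.
  rewrite integral_mkcond; apply: eq_integral => x _; rewrite /patch.
  case: ifPn => xA; first by rewrite in_xsectionX.
  by rewrite notin_xsectionX// measure0 mule0.
- move=> _; rewrite m1E; apply: le_lt_trans fin1; apply: le_measure; rewrite ?inE//.
  by rewrite (_ : Q `&` _ = Q)//; apply/seteqP; split => [z [] | z Qz].
Qed.

(** By uniqueness of Lebesgue measure, its image under [y |-> t + s y] is
    Lebesgue measure divided by s, as one sees on half-open intervals. *)
Lemma integral_affine (R : realType) (t s : R) (F : R -> \bar R) :
  0 < s -> measurable_fun setT F -> (forall x, (0 <= F x)%E) ->
  (\int[lebesgue_measure]_x F x =
   s%:E * \int[lebesgue_measure]_y F (t + s * y)%R)%E.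
Proof.
move=> s0 mF F0.
pose aff (y : measurableTypeR R) : measurableTypeR R := t + s * y.
have maff : measurable_fun setT aff.
  by apply: measurable_funD => //; apply: measurable_funM.
pose sp : {nonneg R} := NngNum (ltW s0).
pose nu : {measure set (measurableTypeR R) -> \bar R} :=
  mscale sp (restricted_image (@lebesgue_measure R) measurableT maff).
have nuE A : nu A = (s%:E * lebesgue_measure (aff @^-1` A))%E.
  by rewrite /nu /= /mscale /= /restricted_image setTI.
have lebE A : measurable A -> lebesgue_measure A = nu A.
  apply: lebesgue_measure_unique => _ [[a b] _ <-].
  rewrite nuE.
  have -> : aff @^-1` [set` `]a, b]] = [set` `](a - t) / s, (b - t) / s]].
    apply/seteqP; split=> y /=; rewrite !in_itv /= /aff ltr_pdivrMr// ler_pdivlMr//;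
    by rewrite ltrBlDl lerBrDl (mulrC s).
  rewrite !lebesgue_measure_itv/= !lte_fin ltr_pM2r ?invr_gt0// ltrBlDl subrKC.
  case: ifPn => _; last by rewrite mule0.
  rewrite -!EFinB -EFinM; congr EFin; field; exact: lt0r_neq0.
rewrite (eq_measure_integral nu); last by move=> A mA _; exact: lebE.
rewrite /nu ge0_integral_mscale//. congr (_ * _)%E.
rewrite -[RHS](@ge0_integral_pushforward _ _ _ _ _ aff maff
  (@lebesgue_measure R) setT F)//.
apply: eq_measure_integral => A mA _.
by rewrite /= /restricted_image /pushforward setTI.
Qed.

(** * The transition kernel *)

Section Kernel.
Context {R : realType} (S : system R) (hTM : assumption_TM S).
Local Notation leb := (@lebesgue_measure R).
Local Notation I := (phase_space S).
Local Notation p := (kernel_p S).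
Local Notation L := (markov_op S).

Lemma Gamma_gt0 : 0 < Gamma S.
Proof. by rewrite subr_gt0; exact: tm_Upsilon hTM. Qed.

Lemma phase_space_measurable : @measurable _ (measurableTypeR R) I.
Proof. exact: measurable_itv. Qed.

Lemma lebesgue_phase_space : leb I = (1 + Gamma S)%:E.
Proof.
rewrite /phase_space lebesgue_measure_itv /= lte_fin.
by rewrite (lt_trans _ ltr01) ?oppr_lt0 ?Gamma_gt0// -EFinB opprK.
Qed.

Lemma sigma_measurable : measurable_fun setT (sigma S).
Proof.
apply: continuous_measurable_fun => x.
exact/differentiable_continuous/derivable1_diffP/(tm_sigma_diff hTM).
Qed.

Lemma noise_density_measurable : measurable_fun setT (noise_density S).
Proof.
apply: measurable_funM => //; apply: measurable_funM.
  apply: continuous_measurable_fun.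
  by have [_] := tm_bump_smooth hTM 0%N.
apply: (measurableT_comp (@measurable_expR R)).
apply: measurable_funN; apply: measurable_funM => //.
Qed.

Lemma noise_density_ge0 x : 0 <= noise_density S x.
Proof.
have b0 y : 0 <= gauss_bump S y.
  by rewrite mulr_ge0 ?expR_ge0// (tm_bump_ge0 hTM).
by rewrite mulr_ge0// invr_ge0 Rintegral_ge0.
Qed.

Lemma kernel_ge0 x z : 0 <= p x z.
Proof. by rewrite mulr_ge0 ?noise_density_ge0// invr_ge0 (tm_sigma_ge0 hTM). Qed.

(** Since sigma is nonnegative, its inverse is a real power of it, including
    at the points where it vanishes. *)
Lemma inv_sigma_measurable : measurable_fun setT (fun x => (sigma S x)^-1).
Proof.
rewrite (_ : (fun x => _) = (fun x => sigma S x `^ (-1))).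
  by apply: (measurableT_comp (measurable_powR _)); exact: sigma_measurable.
by apply/funext => x; rewrite powR_inv1// (tm_sigma_ge0 hTM).
Qed.

Lemma kernel_measurable :
  measurable_fun setT (fun q : R * R => p q.1 q.2).
Proof.
have m1 : measurable_fun setT (fun q : R * R => (sigma S q.1)^-1).
  by apply: (measurableT_comp inv_sigma_measurable); exact: measurable_fst.
apply: measurable_funM => //.
apply: (measurableT_comp noise_density_measurable).
apply: measurable_funM => //; apply: measurable_funB; first exact: measurable_snd.
by apply: (measurableT_comp (tm_meas hTM)); exact: measurable_fst.
Qed.

Lemma kernel_measurablel z : measurable_fun setT (fun x => p x z).
Proof.
exact: (measurable_fun_pair1 z kernel_measurable).
Qed.

Lemma kernel_measurabler x : measurable_fun setT (p x).
Proof.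
exact: (measurable_fun_pair2 x kernel_measurable).
Qed.

Lemma T_noise_measurable : measurable_fun setT (fun q : R * R => T_noise S q.2 q.1).
Proof.
apply: measurable_funD.
  by apply: (measurableT_comp (tm_meas hTM)); exact: measurable_fst.
apply: measurable_funM; last exact: measurable_snd.
by apply: (measurableT_comp sigma_measurable); exact: measurable_fst.
Qed.

(** The kernel is the density of the image of the noise under an affine map.
    Where sigma vanishes this image is a Dirac mass and the kernel is zero. *)
Lemma kernel_law x A : sigma S x != 0 -> measurable A ->
  (\int[leb]_(z in A) (p x z)%:E)%E = noise_law S [set y | A (T_noise S y x)].
Proof.
move=> s0 mA.
have sp : 0 < sigma S x by rewrite lt_neqAle eq_sym s0 (tm_sigma_ge0 hTM).
have mI : measurable [set y | A (T_noise S y x)].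
  have := measurable_fun_pair2 x T_noise_measurable.
  by move=> /(_ measurableT A mA); rewrite setTI.
rewrite integral_mkcond (@integral_affine _ (smap S x) (sigma S x))//; last 2 first.
- apply/(measurable_restrictT _ mA); apply: measurable_funTS.
  by apply/measurable_EFinP; exact: kernel_measurabler.
- by move=> z; apply: erestrict_ge0 => y _; rewrite lee_fin kernel_ge0.
rewrite /noise_law [RHS]integral_mkcond -ge0_integralZl//; last 3 first.
- apply: (@measurableT_comp _ _ _ _ _ _ ((fun z => (p x z)%:E) \_ A) _
    (fun y => smap S x + sigma S x * y)).
    apply/(measurable_restrictT _ mA); apply: measurable_funTS.
    by apply/measurable_EFinP; exact: kernel_measurabler.
  exact: (measurable_fun_pair2 x T_noise_measurable).
- by move=> z _; apply: erestrict_ge0 => y _; rewrite lee_fin kernel_ge0.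
- by rewrite lee_fin ltW.
apply: eq_integral => y _; rewrite /patch /T_noise.
have -> : (smap S x + sigma S x * y \in A) =
    (y \in [set y | A (smap S x + sigma S x * y)]).
  by apply/idP/idP; rewrite !inE.
case: ifPn => _; last by rewrite mule0.
rewrite -EFinM /kernel_p (addrC (smap S x)) addrK mulrA mulfV// mul1r.
by rewrite mulrAC mulfV// mul1r.
Qed.

Lemma kernel_law0 x A : sigma S x = 0 ->
  (\int[leb]_(z in A) (p x z)%:E)%E = 0%E.
Proof.
move=> s0; rewrite (eq_integral (cst 0%E)) ?integral0// => z _.
by rewrite /kernel_p s0 invr0 mul0r.
Qed.

End Kernel.

(** * The Markov operator on bounded functions *)

Section BoundedOn.
Context {R : realType} (S : system R).
Definition bounded_on_phase (f : R -> R) :=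
  exists c : R, forall x, x \in phase_space S -> `|f x| <= c.
End BoundedOn.

Section MarkovOperator.
Context {R : realType} (S : system R) (hTM : assumption_TM S).
Local Notation leb := (@lebesgue_measure R).
Local Notation I := (phase_space S).
Local Notation p := (kernel_p S).
Local Notation L := (markov_op S).
Variable M : R.
Hypothesis pM : forall x z, x \in I -> z \in I -> p x z <= M.

Lemma phase_spaceE x : (x \in I) = (- Gamma S <= x <= 1).
Proof.
rewrite /phase_space; apply/idP/idP; first by rewrite inE /= in_itv.
by move=> xI; rewrite inE /= in_itv.
Qed.

Lemma kernel_bound_ge0 : 0 <= M.
Proof.
have G0 := Gamma_gt0 hTM.
have oI : (0 : R) \in I by rewrite phase_spaceE; apply/andP; split; lra.
exact: le_trans (kernel_ge0 hTM _ _) (pM oI oI).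
Qed.

Lemma bounded_integrable f : measurable_fun setT f -> bounded_on_phase S f ->
  leb.-integrable I (EFin \o f).
Proof.
move=> mf [c fc]; apply: measurable_bounded_integrable.
- exact: phase_space_measurable.
- have : (leb I < +oo)%E by rewrite (lebesgue_phase_space hTM) ltry.
  exact.
- exact: measurable_funTS.
- exists c; split; first exact: num_real.
  by move=> y cy x xI; apply: le_trans (ltW cy); apply: fc; rewrite inE.
Qed.

Lemma kernel_integrable f z : measurable_fun setT f -> bounded_on_phase S f ->
  z \in I -> leb.-integrable I (fun x => (f x * p x z)%:E).
Proof.
move=> mf [c fc] zI.
apply: (@bounded_integrable (fun x => f x * p x z)).
  by apply: measurable_funM => //; exact: kernel_measurablel.
exists (c * M) => x xI; rewrite normrM (ger0_norm (kernel_ge0 hTM _ _)).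
by apply: ler_pM; rewrite ?normr_ge0 ?(kernel_ge0 hTM) ?fc ?pM.
Qed.

Lemma markov_measurable f : measurable_fun setT f -> measurable_fun setT (L f).
Proof.
move=> mf.
pose J := fun q : R * R => ((fun x => (f x * p x q.2)%:E) \_ I) q.1.
have mJ : measurable_fun setT J.
  rewrite (_ : J =
      ((fun q : R * R => (f q.1 * p q.1 q.2)%:E) \_ (I `*` setT))); last first.
    apply/funext => -[x z]; rewrite /J /patch /=.
    by rewrite (_ : (x \in I) = ((x, z) \in I `*` setT))// in_setX in_setT andbT.
  have mIT : measurable (I `*` [set: R]).
    by apply: measurableX; [exact: phase_space_measurable|exact: measurableT].
  apply/(measurable_restrictT _ mIT).
  apply: measurable_funTS; apply/measurable_EFinP; apply: measurable_funM.
    by apply: (measurableT_comp mf); exact: measurable_fst.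
  exact: kernel_measurable.
rewrite /markov_op /Rintegral; apply: (measurableT_comp (fine_measurable measurableT)).
under eq_fun => z do rewrite integral_mkcond integralE.
apply: emeasurable_funB.
  apply: (eq_measurable_fun (fubini_G leb (J^\+)%E)).
    by move=> z _; apply: eq_integral => x _; rewrite !funeposE.
  apply: measurable_fun_fubini_tonelli_G => //; exact: measurable_funepos.
apply: (eq_measurable_fun (fubini_G leb (J^\-)%E)).
  by move=> z _; apply: eq_integral => x _; rewrite !funenegE.
apply: measurable_fun_fubini_tonelli_G => //; exact: measurable_funeneg.
Qed.

Lemma markovD b f1 f2 z :
  measurable_fun setT f1 -> bounded_on_phase S f1 ->
  measurable_fun setT f2 -> bounded_on_phase S f2 -> z \in I ->
  L (fun x => b * f1 x + f2 x) z = b * L f1 z + L f2 z.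
Proof.
move=> m1 b1 m2 b2 zI; rewrite /markov_op.
under eq_Rintegral do rewrite mulrDl -mulrA.
have i1 := kernel_integrable m1 b1 zI; have i2 := kernel_integrable m2 b2 zI.
have i1b : leb.-integrable I (fun x => (b * (f1 x * p x z))%:E).
  apply: (eq_integrable (phase_space_measurable S) _ _ _
    (integrableZl (phase_space_measurable S) b i1)).
  by move=> x _; rewrite -EFinM.
rewrite (RintegralD (phase_space_measurable S) i1b i2).
by rewrite (RintegralZl b (phase_space_measurable S) i1).
Qed.

Lemma eq_markov f1 f2 : {in I, f1 =1 f2} -> L f1 = L f2.
Proof.
move=> f12; apply/funext => z; apply: eq_Rintegral => x xI.
by rewrite f12.
Qed.

Lemma markov_ge0 f z : (forall x, x \in I -> 0 <= f x) -> 0 <= L f z.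
Proof.
move=> f0; apply: Rintegral_ge0 => x xI.
by rewrite mulr_ge0 ?(kernel_ge0 hTM)// f0// inE.
Qed.

Lemma le_markov f1 f2 z :
  measurable_fun setT f1 -> bounded_on_phase S f1 ->
  measurable_fun setT f2 -> bounded_on_phase S f2 -> z \in I ->
  (forall x, x \in I -> f1 x <= f2 x) -> L f1 z <= L f2 z.
Proof.
move=> m1 b1 m2 b2 zI f12; apply: le_Rintegral.
- exact: phase_space_measurable.
- exact: kernel_integrable.
- exact: kernel_integrable.
- by move=> x xI; rewrite ler_wpM2r ?(kernel_ge0 hTM)// f12// inE.
Qed.

Lemma markovE f z : measurable_fun setT f -> bounded_on_phase S f -> z \in I ->
  (L f z)%:E = (\int[leb]_(x in I) (f x * p x z)%:E)%E.
Proof.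
move=> mf bf zI; rewrite fineK//; apply: integrable_fin_num.
  exact: phase_space_measurable.
exact: kernel_integrable.
Qed.

Lemma markov_le_mass f z : measurable_fun setT f -> bounded_on_phase S f ->
  (forall x, x \in I -> 0 <= f x) -> z \in I ->
  L f z <= M * \int[leb]_(x in I) f x.
Proof.
move=> mf bf f0 zI; have i1 := bounded_integrable mf bf.
rewrite -(RintegralZl M (phase_space_measurable S) i1).
apply: le_Rintegral.
- exact: phase_space_measurable.
- exact: kernel_integrable.
- apply: (eq_integrable (phase_space_measurable S) _ _ _
    (integrableZl (phase_space_measurable S) M i1)).
  by move=> x _; rewrite -EFinM.
- by move=> x /mem_set xI; rewrite mulrC ler_wpM2r ?f0 ?pM.
Qed.

End MarkovOperator.

(** * Conservation of mass along the chain *)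

Section MassTransport.
Context {R : realType} (S : system R) (hTM : assumption_TM S).
Local Notation leb := (@lebesgue_measure R).
Local Notation I := (phase_space S).
Local Notation p := (kernel_p S).
Local Notation L := (markov_op S).
Variables (mu : probability (measurableTypeR R) R) (h : R -> R).
Hypothesis hf : standing_facts S mu h.
Variable lam : probability (measurableTypeR R) R.
Hypothesis lamE : forall A, measurable A -> lam A = noise_law S A.

Lemma I_Gamma_bounds x : x \in I_Gamma S -> 0 <= x <= 1 - Gamma S / 2.
Proof.
rewrite /I_Gamma inE /= in_itv /= => /andP[x1 ->]; rewrite andbT.
have G0 := Gamma_gt0 hTM.
have /andP[c0 c1] := tm_crit hTM.
have Tc : smap S (crit S) \in `[0, 1].
  by apply: (tm_map hTM); rewrite in_itv /= !ltW.
have G1 : Gamma S <= 1.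
  by move: Tc; rewrite in_itv /= /Gamma /Upsilon => /andP[]; lra.
have : smap S (1 - Gamma S / 2) \in `[0, 1].
  by apply: (tm_map hTM); rewrite in_itv /=; apply/andP; split; lra.
by rewrite in_itv /= => /andP[T0 _]; lra.
Qed.

Lemma I_Gamma_sub x : x \in I_Gamma S -> x \in I.
Proof.
move=> /I_Gamma_bounds /andP[x1 x2]; rewrite phase_spaceE.
by have G0 := Gamma_gt0 hTM; apply/andP; split; lra.
Qed.

Lemma density_zero x : x \notin I -> h x = 0.
Proof.
by apply: contraNeq => /(sf_support hf); exact: I_Gamma_sub.
Qed.

Lemma density_BV : BV S h. Proof. by have [] := sf_simple hf. Qed.

Lemma BV_bounded f : BV S f -> bounded_on_phase S f.
Proof.
move=> bf; have G0 := Gamma_gt0 hTM.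
have le1 : - Gamma S <= 1 by lra.
exists (`|f (- Gamma S)| + fine (total_variation (- Gamma S) 1 f)) => x.
rewrite phase_spaceE => /andP[x1 x2].
have fin := (bounded_variationP f le1).1 bf.
have : `|f x - f (- Gamma S)| <= fine (total_variation (- Gamma S) 1 f).
  rewrite -lee_fin fineK// (total_variationD f x1 x2).
  apply: (le_trans (total_variation_ge f x1)).
  by rewrite leeDl// total_variation_ge0.
have := ler_normB (f x - f (- Gamma S)) (- f (- Gamma S)).
by rewrite opprK subrK normrN; lra.
Qed.

(** The densities of the state on an event of the past are below the
    stationary density; in particular they vanish outside the phase space. *)
Definition dominated (f : R -> R) :=
  measurable_fun setT f /\ forall x, 0 <= f x <= h x.

Lemma dominated_bounded f : dominated f -> bounded_on_phase S f.
Proof.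
move=> [mf fh]; have [c hc] := BV_bounded density_BV; exists c => x xI.
have /andP[f0 fle] := fh x; rewrite ger0_norm//.
by apply: le_trans (hc x xI); apply: le_trans fle (ler_norm _).
Qed.

Lemma dominated_density : dominated h.
Proof.
by split; [exact: sf_meas hf|move=> x; rewrite (sf_ge0 hf) lexx].
Qed.

Lemma density_mass : (\int[leb]_(x in I) (h x)%:E)%E = 1%E.
Proof.
rewrite -(probability_setT mu) (sf_density hf)// [RHS](_ : _ =
  (\int[leb]_x ((EFin \o h) \_ I) x)%E).
  by rewrite integral_mkcond.
apply: eq_integral => x _; rewrite /patch /=; case: ifPn => // xI.
by rewrite density_zero.
Qed.

Local Open Scope ereal_scope.

Definition landing A x := lam [set y | A (T_noise S y x)].

Lemma landing_measurable A : measurable A -> measurable_fun setT (landing A).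
Proof.
move=> mA.
have mB := T_noise_measurable hTM measurableT mA; rewrite setTI in mB.
apply: eq_measurable_fun (measurable_fun_xsection lam mB) => x _ /=.
by congr (lam _); apply/seteqP; split => y; rewrite /xsection /= inE.
Qed.

(** Equality can fail only where sigma vanishes: there the transition is
    deterministic while the kernel is zero. *)
Lemma kernel_le_landing A x : measurable A ->
  \int[leb]_(z in A) (p x z)%:E <= landing A x.
Proof.
move=> mA; have [s0|s0] := eqVneq (sigma S x) 0%R.
  by rewrite kernel_law0.
rewrite (kernel_law hTM s0)// /landing lamE//.
have := measurable_fun_pair2 x (T_noise_measurable hTM).
by move=> /(_ measurableT A mA); rewrite setTI.
Qed.

Lemma landing_setC A x : measurable A -> landing A x + landing (~` A) x = 1.
Proof.
move=> mA; rewrite /landing.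
have mB : measurable [set y | A (T_noise S y x)].
  have := measurable_fun_pair2 x (T_noise_measurable hTM).
  by move=> /(_ measurableT A mA); rewrite setTI.
rewrite (_ : [set y | (~` A) _] = ~` [set y | A (T_noise S y x)])//.
by rewrite probability_setC// addeC subeK// fin_num_measure.
Qed.

Lemma landing_setT x : landing setT x = 1.
Proof. by rewrite /landing (_ : [set y | _] = setT) ?probability_setT. Qed.

Lemma kernel_mass_measurable K : measurable K ->
  measurable_fun setT (fun x => \int[leb]_(z in K) (p x z)%:E).
Proof.
move=> mK.
pose J := (fun q : R * R => (p q.1 q.2)%:E) \_ (setT `*` K).
have mJ : measurable_fun setT J.
  apply/(measurable_restrictT _ (measurableX measurableT mK)).
  apply: measurable_funTS.
  by apply/measurable_EFinP; exact: kernel_measurable.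
have J0 q : 0 <= J q.
  by apply: erestrict_ge0 => -[x z] _; rewrite lee_fin kernel_ge0.
apply: eq_measurable_fun (@measurable_fun_fubini_tonelli_F _ _
  (measurableTypeR R) (measurableTypeR R) R leb J mJ J0) => x _.
rewrite [RHS]integral_mkcond; apply: eq_integral => z _.
by rewrite /J /patch in_setX in_setT.
Qed.

Lemma markov_integral f A : dominated f -> measurable A ->
  \int[leb]_(z in A `&` I) (L f z)%:E =
  \int[leb]_(x in I) ((f x)%:E * \int[leb]_(z in A `&` I) (p x z)%:E).
Proof.
move=> df mA; have [mf fh] := df; have bf := dominated_bounded df.
have [M pM] := sf_p_bounded hf.
have mI := phase_space_measurable S.
have mK : @measurable _ (measurableTypeR R) (A `&` I) by exact: measurableI.
pose J := (fun q : R * R => (f q.1 * p q.1 q.2)%:E) \_ (I `*` (A `&` I)).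
have JE x z : J (x, z) = ((fun x => (f x * p x z)%:E) \_ I) x *
    ((\1_(A `&` I) z)%:E).
  rewrite /J /patch /= in_setX indicE.
  by case: (x \in I); case: (z \in _); rewrite /= ?mule1 ?mule0 ?mul0e.
have J0 q : 0 <= J q.
  apply: erestrict_ge0 => -[x z] _ /=.
  by rewrite lee_fin mulr_ge0 ?(kernel_ge0 hTM)//; have /andP[] := fh x.
have mJ : measurable_fun setT J.
  apply/(measurable_restrictT _ (measurableX mI mK)); apply: measurable_funTS.
  apply/measurable_EFinP; apply: measurable_funM.
    by apply: (measurableT_comp mf); exact: measurable_fst.
  exact: kernel_measurable.
transitivity (\int[leb]_z \int[leb]_x J (x, z)).
  rewrite integral_mkcond; apply: eq_integral => z _.
  rewrite {1}/patch; case: ifPn => zK.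
    rewrite (markovE hTM pM mf bf); last by move: zK; rewrite !inE => -[].
    rewrite integral_mkcond; apply: eq_integral => x _.
    by rewrite JE indicE zK mule1.
  rewrite integral0_eq// => x _.
  by rewrite JE indicE (negbTE zK) mule0.
transitivity (\int[leb]_x \int[leb]_z J (x, z)).
  exact: (esym (@fubini_tonelli _ _ (measurableTypeR R) (measurableTypeR R)
    R leb leb J mJ J0)).
rewrite [RHS]integral_mkcond; apply: eq_integral => x _.
rewrite [RHS]/patch; case: ifPn => xI; last first.
  by rewrite integral0_eq// => z _; rewrite JE /patch (negbTE xI) mul0e.
rewrite -ge0_integralZl//; last 3 first.
- by apply: measurable_funTS; apply/measurable_EFinP; exact: kernel_measurabler.
- by move=> z _; rewrite lee_fin (kernel_ge0 hTM).
- by rewrite lee_fin; have /andP[] := fh x.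
rewrite [RHS]integral_mkcond; apply: eq_integral => z _.
rewrite JE /patch xI indicE; case: (z \in _); last by rewrite mule0.
by rewrite mule1 EFinM.
Qed.

(** Equality of the totals of two ordered pairs forces equality of the
    terms; this is how conservation of mass is localised to a set and then to a
    density. *)
Lemma squeeze_add (a1 a2 b1 b2 : \bar R) : 0 <= a1 -> 0 <= a2 ->
  a1 <= b1 -> a2 <= b2 -> b1 + b2 < +oo -> a1 + a2 = b1 + b2 -> a1 = b1.
Proof.
move: a1 a2 b1 b2 => [a1| |] [a2| |] [b1| |] [b2| |]//=.
rewrite -!EFinD !lee_fin => _ _ ab1 ab2 _ [e]; congr EFin.
by lra.
Qed.

Lemma dominated_mass_le1 f : dominated f -> \int[leb]_(x in I) (f x)%:E <= 1.
Proof.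
move=> [mf fh]; rewrite -density_mass; apply: ge0_le_integral.
- exact: phase_space_measurable.
- by move=> x _; rewrite lee_fin; have /andP[] := fh x.
- by apply: measurable_funTS; apply/measurable_EFinP.
- by apply: measurable_funTS; apply/measurable_EFinP; exact: sf_meas hf.
- by move=> x _; rewrite lee_fin; have /andP[] := fh x.
Qed.

Lemma markov_le_landing f A : dominated f -> measurable A ->
  \int[leb]_(z in A `&` I) (L f z)%:E <=
  \int[leb]_(x in I) ((f x)%:E * landing A x).
Proof.
move=> df mA; have [mf fh] := df.
have f0 x : 0 <= (f x)%:E by rewrite lee_fin; have /andP[] := fh x.
rewrite markov_integral//; apply: ge0_le_integral.
- exact: phase_space_measurable.
- move=> x _; apply: mule_ge0 => //; apply: integral_ge0 => z _.
  by rewrite lee_fin kernel_ge0.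
- apply: measurable_funTS; apply: emeasurable_funM; first exact/measurable_EFinP.
  apply: kernel_mass_measurable; apply: measurableI => //.
  exact: phase_space_measurable.
- apply: measurable_funTS; apply: emeasurable_funM; first exact/measurable_EFinP.
  exact: landing_measurable.
- move=> x _; apply: lee_wpmul2l => //.
  apply: le_trans (kernel_le_landing x mA).
  apply: ge0_subset_integral => //.
    by apply: measurableI => //; exact: phase_space_measurable.
    by apply: measurable_funTS; apply/measurable_EFinP; exact: kernel_measurabler.
  by move=> z _; rewrite lee_fin kernel_ge0.
Qed.

Lemma markov_split f A : dominated f -> measurable A ->
  \int[leb]_(z in A `&` I) (L f z)%:E + \int[leb]_(z in ~` A `&` I) (L f z)%:E
  = \int[leb]_(z in I) (L f z)%:E.
Proof.
move=> [mf fh] mA; have mI := phase_space_measurable S.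
have mAI : @measurable _ (measurableTypeR R) (A `&` I) by exact: measurableI.
have mAcI : @measurable _ (measurableTypeR R) (~` A `&` I).
  by apply: measurableI => //; exact: measurableC.
rewrite -ge0_integral_setU//.
- by rewrite -setIUl setUv setTI.
- by apply: measurable_funTS; apply/measurable_EFinP; exact: markov_measurable.
- move=> z _; rewrite lee_fin markov_ge0// => x _; by have /andP[] := fh x.
- by rewrite disj_set2E setIACA setICr set0I.
Qed.

Lemma landing_split f A : dominated f -> measurable A ->
  \int[leb]_(x in I) ((f x)%:E * landing A x) +
  \int[leb]_(x in I) ((f x)%:E * landing (~` A) x)
  = \int[leb]_(x in I) (f x)%:E.
Proof.
move=> [mf fh] mA; have mI := phase_space_measurable S.
have f0 x : 0 <= (f x)%:E by rewrite lee_fin; have /andP[] := fh x.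
have mfl B : measurable B -> measurable_fun I (fun x => (f x)%:E * landing B x).
  move=> mB; apply: measurable_funTS; apply: emeasurable_funM.
    exact/measurable_EFinP.
  exact: landing_measurable.
rewrite -ge0_integralD//; last 4 first.
- by move=> x _; apply: mule_ge0.
- exact: mfl.
- by move=> x _; apply: mule_ge0.
- by apply: mfl; exact: measurableC.
apply: eq_integral => x _.
by rewrite -ge0_muleDr ?measure_ge0// landing_setC// mule1.
Qed.

Lemma markov_mass_le f : dominated f ->
  \int[leb]_(z in I) (L f z)%:E <= \int[leb]_(x in I) (f x)%:E.
Proof.
move=> df; have := markov_le_landing df measurableT.
rewrite setTI; under [X in _ <= X -> _]eq_integral do rewrite landing_setT mule1.
exact.
Qed.

Lemma dominatedB f : dominated f -> dominated (fun x => h x - f x)%R.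
Proof.
move=> [mf fh]; split; first by apply: measurable_funB => //; exact: sf_meas hf.
by move=> x; have /andP[f0 f1] := fh x; rewrite subr_ge0 f1 gerBl f0.
Qed.

Lemma dominated_integral_split f : dominated f ->
  \int[leb]_(x in I) (f x)%:E + \int[leb]_(x in I) (h x - f x)%:E = 1.
Proof.
move=> df; have [mf fh] := df; have [mg gh] := dominatedB df.
rewrite -ge0_integralD//; last 5 first.
- exact: phase_space_measurable.
- by move=> x _; rewrite lee_fin; have /andP[] := fh x.
- by apply: measurable_funTS; exact/measurable_EFinP.
- by move=> x _; rewrite lee_fin; have /andP[] := gh x.
- by apply: measurable_funTS; exact/measurable_EFinP.
rewrite -density_mass; apply: eq_integral => x _.
by rewrite -EFinD addrC subrK.
Qed.

(** The operator can only lose mass, and it loses none on h, which it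
    fixes; as h is the sum of f and [h - f], none is lost on f. *)
Lemma markov_mass f : dominated f ->
  \int[leb]_(z in I) (L f z)%:E = \int[leb]_(x in I) (f x)%:E.
Proof.
move=> df; have [mf fh] := df; have dg := dominatedB df; have [mg gh] := dg.
have [M pM] := sf_p_bounded hf.
have Lf0 g : dominated g -> forall z, 0 <= (L g z)%:E.
  move=> [mg' gh'] z; rewrite lee_fin markov_ge0// => x _.
  by have /andP[] := gh' x.
apply: (squeeze_add _ _ (markov_mass_le df) (markov_mass_le dg)).
- by apply: integral_ge0 => z _; exact: Lf0.
- by apply: integral_ge0 => z _; exact: Lf0.
- by rewrite dominated_integral_split// ltry.
rewrite dominated_integral_split// -ge0_integralD//; last 5 first.
- exact: phase_space_measurable.
- by move=> z _; exact: Lf0.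
- by apply: measurable_funTS; apply/measurable_EFinP; exact: markov_measurable.
- by move=> z _; exact: Lf0.
- by apply: measurable_funTS; apply/measurable_EFinP; exact: markov_measurable.
rewrite -density_mass; apply: eq_integral => z zI.
have [_ _ Lh _] := sf_simple hf.
rewrite -(Lh z zI) -EFinD; congr EFin.
rewrite -[X in (X + _)%R]mul1r.
rewrite -(markovD hTM pM) //; try exact: dominated_bounded.
by apply: eq_Rintegral => x _; rewrite mul1r addrC subrK.
Qed.

(** The mass that the kernel carries to A is at most the mass carried there
    by the chain, and likewise for the complement of A, while the totals agree
    by [markov_mass].  This excludes that h charges the zeros of sigma, or that
    the chain leaves the phase space from a point charged by h. *)
Lemma markov_landing f A : dominated f -> measurable A ->
  \int[leb]_(z in A `&` I) (L f z)%:E =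
  \int[leb]_(x in I) ((f x)%:E * landing A x).
Proof.
move=> df mA; have [mf fh] := df.
have Lf0 z : 0 <= (L f z)%:E.
  by rewrite lee_fin markov_ge0// => x _; have /andP[] := fh x.
have mAc := measurableC mA.
apply: (squeeze_add _ _ (markov_le_landing df mA) (markov_le_landing df mAc)).
- by apply: integral_ge0.
- by apply: integral_ge0.
- by rewrite landing_split// (le_lt_trans (dominated_mass_le1 df))// ltry.
- by rewrite markov_split// landing_split// markov_mass.
Qed.

End MassTransport.

(** * Bounded variation on the phase space *)

Section BVBounds.
Context {R : realType} (S : system R) (hTM : assumption_TM S).
Local Notation leb := (@lebesgue_measure R).
Local Notation I := (phase_space S).
Local Notation p := (kernel_p S).
Local Notation L := (markov_op S).

Lemma phase_space_le : - Gamma S <= 1.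
Proof. by have := Gamma_gt0 hTM; lra. Qed.

(** The two points cut the phase space into three intervals over which the
    total variation is additive. *)
Lemma oscillation_le f x y : x \in I -> y \in I ->
  (`|f x - f y|%:E <= total_variation (- Gamma S) 1 f)%E.
Proof.
wlog xy : x y / y <= x => [hwlog xI yI|].
  have [|/ltW] := leP y x => yx; first exact: hwlog.
  by rewrite distrC; exact: hwlog.
rewrite !phase_spaceE => /andP[x1 x2] /andP[y1 y2].
rewrite (total_variationD f y1 y2) (total_variationD f xy x2).
apply: (le_trans (total_variation_ge f xy)).
rewrite addeCA leeDl// adde_ge0// total_variation_ge0//.
Qed.

(** The absolute value of a function of total variation V stays above
    [`|f x| - V], so its integral
    controls the supremum; the constant is 1 since the phase space has length
    at least 1. *)
Lemma sup_le_bv_norm (f : R -> R) x : measurable_fun setT f -> x \in I ->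
  (`|f x|%:E <= bv_norm S f)%E.
Proof.
move=> mf xI; have mI := phase_space_measurable S.
have G0 := Gamma_gt0 hTM.
rewrite /bv_norm; set V := total_variation _ _ _.
have V0 : (0 <= V)%E by apply: total_variation_ge0; exact: phase_space_le.
have [->|Vfin] := eqVneq V +oo%E.
  by rewrite addye ?leey// -ltNye (lt_le_trans _ (integral_ge0 _ _))// => y _.
have Vf : V \is a fin_num by rewrite ge0_fin_numE// ltey.
have mabs : measurable_fun I (fun y => (`|f y|)%:E).
  by apply: measurable_funTS; apply/measurable_EFinP; exact: measurableT_comp.
(* the constant [`|f x| - V] lies below [`|f|] on the whole phase space *)
have h1 : ((`|f x| - fine V)%:E * (1 + Gamma S)%:E <=
    \int[leb]_(y in I) (`|f y|)%:E)%E.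
  have [neg|pos] := leP (`|f x| - fine V) 0.
    rewrite -EFinM; apply: (@le_trans _ _ 0%E); last exact: integral_ge0.
    by rewrite lee_fin mulr_le0_ge0// addr_ge0// ltW.
  rewrite -(lebesgue_phase_space hTM) -integral_cst//.
  apply: ge0_le_integral => //.
    by move=> y _; rewrite lee_fin ltW.
  move=> y /mem_set yI; rewrite lee_fin lerBlDr.
  have : `|f x - f y| <= fine V by rewrite -lee_fin fineK// oscillation_le.
  by have := ler_normD (f x - f y) (f y); rewrite subrK; lra.
have := @integral_ge0 _ _ _ leb I (fun y => (`|f y|)%:E) (fun y _ => normr_ge0 (f y)).
move: h1; case: (\int[leb]_(y in I) _)%E => [r| |] //; last first.
  by move=> _ _; rewrite addey ?leey// -ltNye (lt_le_trans _ V0).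
rewrite -EFinM !lee_fin => h1 r0; rewrite -(fineK Vf) -EFinD lee_fin.
have [neg|pos] := leP (`|f x| - fine V) 0; first by lra.
have : 0 <= (`|f x| - fine V) * Gamma S by rewrite mulr_ge0// ltW.
by move: h1; rewrite mulrDr mulr1; lra.
Qed.

Lemma variationZ b (f : R -> R) s :
  variation (- Gamma S) 1 (fun x => b * f x) s =
  `|b| * variation (- Gamma S) 1 f s.
Proof.
rewrite /variation big_distrr /=; apply: eq_bigr => i _.
by rewrite -mulrBr normrM.
Qed.

Lemma BV_lin b f1 f2 : BV S f1 -> BV S f2 -> BV S (fun x => b * f1 x + f2 x).
Proof.
move=> [r hr] bf2; apply: (bounded_variationD _ _ bf2).
  by have := Gamma_gt0 hTM; lra.
exists (`|b| * r) => _ [s ps <-]; rewrite variationZ ler_wpM2l//.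
by apply: hr; exists s.
Qed.

Lemma bv_norm_lty f : measurable_fun setT f -> BV S f -> (bv_norm S f < +oo)%E.
Proof.
move=> mf bf; rewrite /bv_norm lte_add_pinfty//.
  have := (bounded_variationP f phase_space_le).1 bf.
  by rewrite ge0_fin_numE// total_variation_ge0// phase_space_le.
have := bounded_integrable hTM mf (BV_bounded hTM bf).
by move=> /integrableP[].
Qed.

Lemma bv_norm_ge0 f : (0 <= bv_norm S f)%E.
Proof.
rewrite adde_ge0//; first by apply: total_variation_ge0; exact: phase_space_le.
by apply: integral_ge0 => x _; rewrite lee_fin.
Qed.

Lemma BV_of_bv_norm f : (bv_norm S f < +oo)%E -> BV S f.
Proof.
move=> fin; apply/(bounded_variationP f phase_space_le).
rewrite ge0_fin_numE; last by apply: total_variation_ge0; exact: phase_space_le.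
apply: le_lt_trans fin; rewrite leeDl//.
by apply: integral_ge0 => x _; rewrite lee_fin.
Qed.

Lemma itv_partition_mem s i : itv_partition (- Gamma S) 1 s ->
  (i < (size s).+1)%N -> nth 1 (- Gamma S :: s) i \in I.
Proof.
move=> ps lti; rewrite phase_spaceE.
by rewrite itv_partition_nth_ge// itv_partition_nth_le.
Qed.

(** The finite essential supremum of the total variations gives one bound
    for all partitions at almost every x. *)
Lemma kernel_variation mu h : standing_facts S mu h ->
  exists2 V : R, 0 <= V & \forall x \ae leb, I x ->
    forall s, itv_partition (- Gamma S) 1 s ->
      variation (- Gamma S) 1 (p x) s <= V.
Proof.
move=> hf; have pvar := sf_p_var hf.
set F := (_ \_ _) in pvar.
have ge := ess_sup_ge leb F.
have [V V0 eV] : exists2 V : R, 0 <= V & (ess_sup leb F <= V%:E)%E.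
  move: pvar; case: (ess_sup leb F) => [r _| |_] //; last first.
    by exists 0 => //; rewrite leNye.
  by exists (Num.max r 0); rewrite ?le_max ?lexx ?orbT// lee_fin le_max lexx.
exists V => //; apply: filterS ge => x Fx /mem_set xI s ps.
rewrite -lee_fin; apply: le_trans eV; apply: le_trans Fx.
rewrite /F /patch xI; apply: ereal_sup_ubound.
exists (variation (- Gamma S) 1 (p x) s) => //.
by exists s.
Qed.

(** Averaging over x the variation of the kernel in its second variable
    bounds the variation of the image by a multiple of the mass of f: one
    application of the operator turns integrable functions into functions of
    bounded variation. *)
Lemma markov_bv mu h : standing_facts S mu h ->
  exists2 K : R, 0 <= K & forall f, measurable_fun setT f ->
    bounded_on_phase S f -> (forall x, 0 <= f x) ->
    (bv_norm S (L f) <= (K * \int[leb]_(x in I) f x)%:E)%E.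
Proof.
move=> hf; have [V V0 pV] := kernel_variation hf.
have [M pM] := sf_p_bounded hf.
have M0 := kernel_bound_ge0 hTM pM.
have mI := phase_space_measurable S; have G0 := Gamma_gt0 hTM.
exists (V + M * (1 + Gamma S)) => [|f mf bf f0].
  by rewrite addr_ge0// mulr_ge0// addr_ge0// ltW.
have Lf0 z : 0 <= L f z by apply: markov_ge0 => // x _.
have int0 : 0 <= \int[leb]_(x in I) f x by apply: Rintegral_ge0.
rewrite mulrDl EFinD /bv_norm; apply: leeD.
  apply: ge_ereal_sup => _ [_ [s ps <-] <-]; rewrite lee_fin.
  rewrite -(RintegralZl V mI (bounded_integrable hTM mf bf)).
  have iVf : leb.-integrable I (fun x => (V * f x)%:E).
    apply: (eq_integrable mI _ _ _ (integrableZl mI V (bounded_integrable hTM mf bf))).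
    by move=> x _; rewrite -EFinM.
  pose t i := nth 1 (- Gamma S :: s) i.
  have tI i : (i < (size s).+1)%N -> t i \in I by exact: itv_partition_mem.
  pose D i x := f x * `|p x (t i.+1) - p x (t i)|.
  have mD i : measurable_fun setT (D i).
    apply: measurable_funM => //; apply: measurableT_comp => //.
    by apply: measurable_funB; exact: kernel_measurablel.
  have D0 i x : 0 <= D i x by rewrite mulr_ge0.
  have step i : (i < size s)%N ->
      (`|L f (t i.+1) - L f (t i)|%:E <= \int[leb]_(x in I) (D i x)%:E)%E.
    move=> lti; have t1 := tI i.+1 lti; have t0 := tI i (ltnW lti).
    have i1 := kernel_integrable hTM pM mf bf t1.
    have i0 := kernel_integrable hTM pM mf bf t0.
    rewrite /markov_op -(RintegralB mI i1 i0).
    have iB : leb.-integrable I (fun x => (f x * p x (t i.+1) - f x * p x (t i))%:E).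
      apply: (eq_integrable mI _ _ _ (integrableB mI i1 i0)).
      by move=> x _; rewrite -EFinB.
    rewrite (EFin_normr_Rintegral mI iB).
    apply: (le_trans (le_abse_integral _ mI _)).
      by have /integrableP[] := iB.
    rewrite le_eqVlt; apply/orP; left; apply/eqP; apply: eq_integral => x _.
    by rewrite /= -mulrBr normrM ger0_norm.
  rewrite -lee_fin /Rintegral fineK; last exact: integrable_fin_num.
  rewrite /variation -sumEFin.
  apply: (@le_trans _ _ (\sum_(0 <= i < size s) \int[leb]_(x in I) (D i x)%:E)%E).
    rewrite !big_nat; apply: lee_sum => i /andP[_ lti]; exact: step.
  rewrite -ge0_integral_sum//; last 2 first.
  - by move=> i; apply: measurable_funTS; apply/measurable_EFinP; exact: mD.
  - by move=> i x _; rewrite lee_fin.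
  apply: ae_ge0_le_integral => //.
  - by move=> x _; apply: sume_ge0 => i _; rewrite lee_fin.
  - apply: emeasurable_sum => i; apply: measurable_funTS.
    by apply/measurable_EFinP; exact: mD.
  - by move=> x _; rewrite lee_fin mulr_ge0.
  - by apply: measurable_funTS; apply/measurable_EFinP; exact: measurable_funM.
  apply: negligibleS pV => x nP pVx; apply: nP => xI; have pxV := pVx xI s ps.
  rewrite sumEFin lee_fin /D -big_distrr /= mulrC ler_wpM2r//.
apply: (@le_trans _ _ (\int[leb]_(x in I) (M * \int[leb]_(x in I) f x)%:E)%E).
  apply: ge0_le_integral => //.
  - apply: measurable_funTS; apply/measurable_EFinP; apply: measurableT_comp => //.
    exact: markov_measurable.
  - move=> z /mem_set zI; rewrite lee_fin ger0_norm//.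
    exact: (markov_le_mass hTM pM).
rewrite integral_cst// [X in (_ * X <= _)%E](lebesgue_phase_space hTM) -EFinM lee_fin.
by rewrite mulrAC.
Qed.
End BVBounds.

(** * Perturbations of the Markov operator under a spectral gap *)

Section GapPerturbation.
Context {R : realType} (S : system R) (hTM : assumption_TM S).
Local Notation leb := (@lebesgue_measure R).
Local Notation I := (phase_space S).
Local Notation L := (markov_op S).
Variables (mu : probability (measurableTypeR R) R) (h : R -> R).
Hypothesis hf : standing_facts S mu h.

Definition measurable_BV (f : R -> R) := measurable_fun setT f /\ BV S f.

Lemma measurable_BV_bounded f : measurable_BV f -> bounded_on_phase S f.
Proof. by move=> [_]; exact: BV_bounded. Qed.

Lemma measurable_BV_density : measurable_BV h.
Proof. by split; [exact: sf_meas hf|exact: (density_BV hf)]. Qed.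

Lemma measurable_BV_lin b f1 f2 : measurable_BV f1 -> measurable_BV f2 ->
  measurable_BV (fun x => b * f1 x + f2 x).
Proof.
move=> [m1 b1] [m2 b2]; split; last exact: BV_lin.
by apply: measurable_funD => //; apply: measurable_funM.
Qed.

Lemma bv_norm_eq0 f : {in I, f =1 cst 0} -> bv_norm S f = 0%E.
Proof.
move=> f0; have G0 := Gamma_gt0 hTM; rewrite /bv_norm.
rewrite [X in (_ + X)%E](_ : _ = 0%E) ?adde0; last first.
  by apply: integral0_eq => x /mem_set xI; rewrite f0// normr0.
apply/eqP; rewrite eq_le; apply/andP; split; last first.
  by apply: total_variation_ge0; lra.
apply: ge_ereal_sup => _ [_ [s ps <-] <-]; rewrite lee_fin.
rewrite /variation big_nat big1// => i /andP[_ lti].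
have t1 := itv_partition_mem (i := i.+1) ps lti.
have t0 := itv_partition_mem ps (ltnW lti : (i < (size s).+1)%N).
by rewrite [_.+1]lock /= -lock f0// f0// subrr normr0.
Qed.

Section Projection.
Variables (l : (R -> R) -> R) (C rho : R).
Hypotheses
  (l_lin : forall (b : R) f1 f2, BV S f1 -> BV S f2 ->
     l (fun x => b * f1 x + f2 x) = b * l f1 + l f2)
  (l_bnd : exists M : R, forall f, BV S f ->
     ((`|l f|)%:E <= M%:E * bv_norm S f)%E)
  (l_h : l h = 1)
  (rho0 : 0 <= rho) (rho1 : rho < 1)
  (decay : forall f (n : nat), BV S f ->
     (bv_norm S (iter n (residual_op S h l) f)
        <= (C * rho ^+ n)%:E * bv_norm S f)%E).
Local Notation Q := (residual_op S h l).

(** The projection is given on total functions, but its continuity for the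
    BV norm on the phase space makes it blind to values elsewhere. *)
Lemma projection_eq f1 f2 : measurable_BV f1 -> measurable_BV f2 -> {in I, f1 =1 f2} ->
  l f1 = l f2.
Proof.
move=> [_ b1] [_ b2] f12; have [M lM] := l_bnd.
have := lM _ (BV_lin hTM (-1) b1 b2).
rewrite bv_norm_eq0; last by move=> x xI; rewrite /= f12// mulN1r addNr.
rewrite mule0 l_lin// lee_fin normr_le0 mulN1r addrC subr_eq0 => /eqP ->//.
Qed.

Lemma residual_eq f1 f2 : measurable_BV f1 -> measurable_BV f2 -> {in I, f1 =1 f2} ->
  Q f1 = Q f2.
Proof.
move=> g1 g2 f12; apply/funext => x.
by rewrite /residual_op (projection_eq g1 g2 f12) (eq_markov f12).
Qed.

Lemma residual_measurable_BV f : measurable_BV f -> measurable_BV (Q f).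
Proof.
move=> [mf bf]; have [mh bh] := measurable_BV_density.
split.
  apply: measurable_funB; first exact: markov_measurable.
  exact: measurable_funM.
apply: (BV_of_bv_norm hTM); apply: (le_lt_trans (decay 1 bf)).
rewrite -(fineK (_ : bv_norm S f \is a fin_num)) -?EFinM ?ltry//.
by rewrite ge0_fin_numE ?bv_norm_ge0// bv_norm_lty.
Qed.

Lemma residual_iter_eq n f1 f2 : measurable_BV f1 -> measurable_BV f2 ->
  {in I, f1 =1 f2} ->
  {in I, iter n Q f1 =1 iter n Q f2}.
Proof.
case: n => [//|n] g1 g2 f12 x xI.
by rewrite !iterSr (residual_eq g1 g2 f12).
Qed.

Lemma residual_iter_lin n b f1 f2 : measurable_BV f1 -> measurable_BV f2 ->
  {in I, iter n Q (fun x => b * f1 x + f2 x) =1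
         fun x => b * iter n Q f1 x + iter n Q f2 x}.
Proof.
have [M pM] := sf_p_bounded hf.
elim: n f1 f2 => [//|n IH] f1 f2 g1 g2 x xI.
have [m1 b1] := g1; have [m2 b2] := g2.
rewrite !iterSr -IH//; try exact: residual_measurable_BV.
apply: residual_iter_eq => //.
- by apply: residual_measurable_BV; exact: measurable_BV_lin.
- by apply: measurable_BV_lin; exact: residual_measurable_BV.
move=> z zI; rewrite /residual_op l_lin// (markovD hTM pM) //.
- by ring.
- exact: measurable_BV_bounded.
- exact: measurable_BV_bounded.
Qed.

(** The density is fixed by the operator and normalised by the projection,
    hence annihilated by the residual operator. *)
Lemma residual_iter_density n : {in I, iter n.+1 Q h =1 cst 0}.
Proof.
have [_ _ Lh _] := sf_simple hf.
have Qh : {in I, Q h =1 cst 0}.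
  by move=> x xI; rewrite /residual_op Lh// l_h mul1r subrr.
have gh := measurable_BV_density.
have gQ := residual_measurable_BV gh.
move=> x xI; rewrite iterSr.
(* [Q h] vanishes on the phase space, hence agrees there with [- Q h + Q h] *)
rewrite (residual_iter_eq n (f2 := fun x => -1 * Q h x + Q h x) gQ _ _ xI).
- by rewrite residual_iter_lin// mulN1r addNr.
- exact: measurable_BV_lin.
- by move=> z zI; rewrite Qh// mulr0 addr0.
Qed.

Lemma residual_iter_bound n f e : measurable_BV f -> (bv_norm S f <= e%:E)%E ->
  forall x, x \in I -> `|iter n Q f x| <= `|C| * rho ^+ n * e.
Proof.
move=> gf fe x xI; rewrite -lee_fin.
have gn : measurable_BV (iter n Q f).
  by elim: n => //= n IH; exact: residual_measurable_BV.
apply: (le_trans (sup_le_bv_norm hTM gn.1 xI)).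
apply: (le_trans (decay n gf.2)); rewrite [leRHS]EFinM.
apply: (@le_trans _ _ ((`|C| * rho ^+ n)%:E * bv_norm S f)%E).
  apply: lee_wpmul2r; first exact: bv_norm_ge0.
  by rewrite lee_fin ler_wpM2r ?exprn_ge0// ler_norm.
by apply: lee_wpmul2l => //; rewrite lee_fin mulr_ge0// exprn_ge0.
Qed.

Variables (w q : nat -> R -> R) (e : R).
Hypotheses (e0 : 0 <= e) (q0 : q 0%N = h)
  (BVq : forall k, measurable_BV (q k)) (BVw : forall k, measurable_BV (w k))
  (we : forall k, (bv_norm S (w k) <= e%:E)%E)
  (qS : forall k x, x \in I -> q k.+1 x = L (q k) x - w k x).

Lemma perturbed_step k : {in I, q k.+1 =1
  fun x => l (q k) * h x + (-1 * w k x + Q (q k) x)}.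
Proof. by move=> x xI; rewrite qS// /residual_op; ring. Qed.

(** The residual operator kills the component along h, so only the past
    perturbations contribute, each discounted by rho per elapsed step. *)
Lemma perturbed_residual k n x : x \in I ->
  `|iter n.+1 Q (q k) x| <= `|C| * e * rho ^+ n.+1 / (1 - rho).
Proof.
have r1 : 0 < 1 - rho by rewrite subr_gt0.
elim: k n x => [|k IH] n x xI.
  rewrite q0 residual_iter_density// normr0.
  by rewrite divr_ge0 ?(ltW r1)// mulr_ge0 ?exprn_ge0// mulr_ge0.
have gQ := residual_measurable_BV (BVq k).
have g2 : measurable_BV (fun x => -1 * w k x + Q (q k) x) by exact: measurable_BV_lin.
have g1 := measurable_BV_lin (l (q k)) measurable_BV_density g2.
rewrite (residual_iter_eq n.+1 (BVq k.+1) g1 (perturbed_step k) xI).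
rewrite (residual_iter_lin _ _ measurable_BV_density g2)//.
rewrite (residual_iter_density _ xI) mulr0 add0r.
rewrite (residual_iter_lin _ _ (BVw k) gQ)// -iterSr.
apply: (le_trans (ler_normD _ _)); rewrite mulN1r normrN.
have a1 := residual_iter_bound n.+1 (BVw k) (we k) xI.
have a2 := IH n.+1 x xI.
apply: (le_trans (lerD a1 a2)); rewrite le_eqVlt; apply/orP; left; apply/eqP.
by rewrite [rho ^+ n.+2]exprS; field; rewrite gt_eqF.
Qed.

(** One step after time k the component along h has coefficient [l (q k)];
    what remains is the contracted residual and the last perturbation. *)
Lemma perturbed_density k : exists a : R, forall x, x \in I ->
  `|q k x - a * h x| <= (`|C| * rho / (1 - rho) + 1) * e.
Proof.
have r1 : 0 < 1 - rho by rewrite subr_gt0.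
case: k => [|k].
  exists 1 => x xI; rewrite q0 mul1r subrr normr0 mulr_ge0//.
  by rewrite addr_ge0// divr_ge0 ?(ltW r1)// mulr_ge0.
exists (l (q k)) => x xI; rewrite perturbed_step// addrC addKr mulN1r.
apply: (le_trans (ler_normD _ _)); rewrite normrN mulrDl mul1r addrC.
apply: lerD.
  have := perturbed_residual k 0 xI; rewrite /= expr1.
  by move/le_trans; apply; rewrite le_eqVlt; apply/orP; left; apply/eqP; ring.
rewrite -lee_fin; apply: le_trans (we k).
by apply: sup_le_bv_norm => //; have [] := BVw k.
Qed.

End Projection.

(** A sequence of densities that follows the Markov operator up to
    perturbations of size e in BV stays within a multiple of e of the line of h,
    uniformly in time. *)
Lemma spectral_gap_perturbation : exists2 K : R, 0 <= K &
  forall (w q : nat -> R -> R) (e : R), 0 <= e -> q 0%N = h ->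
    (forall k, measurable_BV (q k)) -> (forall k, measurable_BV (w k)) ->
    (forall k, (bv_norm S (w k) <= e%:E)%E) ->
    (forall k x, x \in I -> q k.+1 x = L (q k) x - w k x) ->
    forall k, exists a : R, forall x, x \in I ->
      `|q k x - a * h x| <= K * e.
Proof.
have [l [l_lin l_bnd l_h _ [C [rho [rho0 rho1 decay]]]]] := sf_gap hf.
exists (`|C| * rho / (1 - rho) + 1).
  by rewrite addr_ge0// divr_ge0 ?mulr_ge0 ?subr_ge0 ?(ltW rho1).
move=> w q e e0 q0 gk BVw we qS.
exact: (perturbed_density l_lin l_bnd l_h rho0 rho1 decay e0 q0 gk BVw we qS).
Qed.

End GapPerturbation.

(** * Survival mass of the open system *)

Section Survival.
Context {R : realType} (S : system R) (hTM : assumption_TM S).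
Local Notation leb := (@lebesgue_measure R).
Local Notation I := (phase_space S).
Local Notation L := (markov_op S).
Variables (mu : probability (measurableTypeR R) R) (h : R -> R).
Hypothesis hf : standing_facts S mu h.
Variable lam : probability (measurableTypeR R) R.
Hypothesis lamE : forall A, measurable A -> lam A = noise_law S A.

Lemma Rintegral_lin b g1 g2 :
  measurable_fun setT g1 -> bounded_on_phase S g1 ->
  measurable_fun setT g2 -> bounded_on_phase S g2 ->
  \int[leb]_(x in I) (b * g1 x + g2 x) =
  b * \int[leb]_(x in I) g1 x + \int[leb]_(x in I) g2 x.
Proof.
move=> m1 b1 m2 b2; have mI := phase_space_measurable S.
have i1 := bounded_integrable hTM m1 b1; have i2 := bounded_integrable hTM m2 b2.
have i1b : leb.-integrable I (fun x => (b * g1 x)%:E).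
  apply: (eq_integrable mI _ _ _ (integrableZl mI b i1)).
  by move=> x _; rewrite -EFinM.
by rewrite (RintegralD mI i1b i2) (RintegralZl b mI i1).
Qed.

Lemma Rintegral_bound (g : R -> R) c : measurable_fun setT g ->
  (forall x, x \in I -> `|g x| <= c) ->
  `|\int[leb]_(x in I) g x| <= c * (1 + Gamma S).
Proof.
move=> mg gc; have mI := phase_space_measurable S.
have bg : bounded_on_phase S g by exists c.
have ig := bounded_integrable hTM mg bg.
have ig' : leb.-integrable I (EFin \o (fun x => `|g x|)).
  apply: bounded_integrable => //; first exact: measurableT_comp.
  by exists c => x xI; rewrite normr_id gc.
have ic : leb.-integrable I (EFin \o cst c).
  by apply: bounded_integrable => //; exists `|c|.
apply: (le_trans (le_normr_Rintegral mI ig)).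
apply: (@le_trans _ _ (\int[leb]_(x in I) (cst c x))).
  by apply: le_Rintegral => // x /mem_set xI; exact: gc.
rewrite Rintegral_cst// [X in (_ * fine X <= _)](lebesgue_phase_space hTM).
exact: lexx.
Qed.

Lemma Rintegral_mono g1 g2 :
  measurable_fun setT g1 -> bounded_on_phase S g1 ->
  measurable_fun setT g2 -> bounded_on_phase S g2 ->
  (forall x, x \in I -> g1 x <= g2 x) ->
  \int[leb]_(x in I) g1 x <= \int[leb]_(x in I) g2 x.
Proof.
move=> m1 b1 m2 b2 g12; apply: le_Rintegral.
- exact: phase_space_measurable.
- exact: bounded_integrable.
- exact: bounded_integrable.
- by move=> x /mem_set xI; exact: g12.
Qed.

Lemma BV_eq (g1 g2 : R -> R) : {in I, g1 =1 g2} -> BV S g1 -> BV S g2.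
Proof.
move=> g12 [r hr]; exists r => _ [s ps <-].
rewrite (_ : variation _ _ g2 s = variation (- Gamma S) 1 g1 s).
  by apply: hr; exists s.
rewrite /variation !big_nat; apply: eq_bigr => i /andP[_ lti].
have t1 := itv_partition_mem (i := i.+1) ps lti.
have t0 := itv_partition_mem ps (ltnW lti : (i < (size s).+1)%N).
by rewrite [_.+1]lock /= -lock g12// g12.
Qed.

Lemma dominated_Rintegral g : dominated h g ->
  (\int[leb]_(x in I) g x)%:E = (\int[leb]_(x in I) (g x)%:E)%E.
Proof.
move=> dg; rewrite /Rintegral fineK//; apply: integrable_fin_num.
  exact: phase_space_measurable.
by apply: bounded_integrable => //; [case: dg|exact: (dominated_bounded hTM hf)].
Qed.

Section Hole.
Variable f : R -> R.
Hypotheses (mf : measurable_fun setT f) (f01 : forall x, 0 <= f x <= 1).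

(** The indicator keeps the density at zero off the phase space, where
    nothing is known about the kernel. *)
Fixpoint survivor (k : nat) : R -> R :=
  if k is k'.+1 then
    fun z => \1_I z * L (fun x => (1 - f x) * survivor k' x) z
  else h.

Lemma dominatedM (g s : R -> R) : measurable_fun setT g -> (forall x, 0 <= g x <= 1) ->
  dominated h s -> dominated h (fun x => g x * s x).
Proof.
move=> mg g01 [ms sh]; split; first exact: measurable_funM.
move=> x; have /andP[g0 g1] := g01 x; have /andP[s0 s1] := sh x.
by rewrite mulr_ge0//=; apply: le_trans s1; rewrite ler_piMl.
Qed.

Lemma escape_compl_bounds x : 0 <= 1 - f x <= 1.
Proof. by have /andP[] := f01 x; lra. Qed.

Lemma escape_compl_measurable : measurable_fun setT (fun x => 1 - f x).
Proof. exact: measurable_funB. Qed.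

(** The open operator is below the Markov operator, which fixes h. *)
Lemma survivor_dominated k : dominated h (survivor k).
Proof.
elim: k => [|k IH] /=; first exact: (dominated_density hf).
have [M pM] := sf_p_bounded hf.
have d1 := dominatedM escape_compl_measurable escape_compl_bounds IH.
have [m1 h1] := d1; have [mh hh] := dominated_density hf.
split.
  apply: measurable_funM; first exact: measurable_indic (phase_space_measurable S).
  exact: markov_measurable.
move=> z; rewrite indicE; case: (boolP (z \in I)) => zI /=; last first.
  by rewrite mul0r lexx (sf_ge0 hf).
rewrite mul1r markov_ge0//=; last by move=> x _; have /andP[] := h1 x.
have [_ _ Lh _] := sf_simple hf.
rewrite -[leRHS](Lh z zI); apply: (le_markov hTM pM) => //.
- exact: (dominated_bounded hTM hf).
- exact: (dominated_bounded hTM hf (dominated_density hf)).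
- by move=> x _; have /andP[] := h1 x.
Qed.

Lemma markov_dominated_BV g : dominated h g -> measurable_BV S (L g).
Proof.
move=> dg; have [mg gh] := dg.
have [K K0 bvK] := markov_bv hTM hf.
have bg := dominated_bounded hTM hf dg.
split; first exact: markov_measurable.
apply: (BV_of_bv_norm hTM); apply: (le_lt_trans (bvK g mg bg _)).
  by move=> x; have /andP[] := gh x.
by rewrite ltry.
Qed.

Lemma survivor_BV k : measurable_BV S (survivor k).
Proof.
case: k => [|k]; first exact: (measurable_BV_density hf).
have d1 := dominatedM escape_compl_measurable escape_compl_bounds
  (survivor_dominated k).
have [m1 b1] := markov_dominated_BV d1.
split; first by have [] := survivor_dominated k.+1.
apply: BV_eq b1 => z zI /=.
by rewrite indicE zI mul1r.
Qed.

Lemma survivor_step k x : x \in I ->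
  survivor k.+1 x = L (survivor k) x - L (fun x => f x * survivor k x) x.
Proof.
move=> xI; have [M pM] := sf_p_bounded hf.
have d1 := dominatedM mf f01 (survivor_dominated k).
rewrite /= indicE xI mul1r.
transitivity (L (fun x => -1 * (f x * survivor k x) + survivor k x) x).
  by congr (L _ x); apply/funext => z; ring.
rewrite (markovD hTM pM)//.
- by rewrite mulN1r addrC.
- by case: d1.
- exact: (dominated_bounded hTM hf).
- by case: (survivor_dominated k).
- exact: (dominated_bounded hTM hf (survivor_dominated k)).
Qed.

Definition survival k := \int[leb]_(x in I) survivor k x.

Definition escape_rate := \int[leb]_(x in I) (f x * h x).

Lemma survival0 : survival 0 = 1.
Proof. by rewrite /survival /Rintegral /= (density_mass hTM hf). Qed.

Lemma survival_bound k : `|survival k| <= 1.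
Proof.
have [_ sh] := survivor_dominated k.
rewrite ger0_norm; last by apply: Rintegral_ge0 => x _; have /andP[] := sh x.
rewrite -lee_fin (dominated_Rintegral (survivor_dominated k)).
exact: (dominated_mass_le1 hTM hf (survivor_dominated k)).
Qed.

(** Applying the Markov operator preserves mass, so mass is lost only
    through f. *)
Lemma survivalS k :
  survival k.+1 = survival k - \int[leb]_(x in I) (f x * survivor k x).
Proof.
have d0 := survivor_dominated k.
have d1 := dominatedM mf f01 d0.
have d2 := dominatedM escape_compl_measurable escape_compl_bounds d0.
transitivity (\int[leb]_(x in I) ((1 - f x) * survivor k x)).
  rewrite /survival /Rintegral -(markov_mass hTM hf lamE d2).
  congr fine; apply: eq_integral => x xI /=.
  by rewrite indicE xI mul1r.
transitivity (\int[leb]_(x in I) (-1 * (f x * survivor k x) + survivor k x)).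
  by apply: eq_Rintegral => x _; ring.
rewrite Rintegral_lin; first by rewrite mulN1r addrC.
- by case: d1.
- exact: (dominated_bounded hTM hf).
- by case: d0.
- exact: (dominated_bounded hTM hf).
Qed.

End Hole.

(** The loss in one step is the integral of f against the surviving density.
    Replacing this density by [survival f k] times h gives
    [escape_rate f * survival f k], at the price of a multiple of the escape rate
    times the Lebesgue integral of f, which kappa bounds by the escape rate.
    The constant depends on the system and on kappa only. *)
Lemma survival_recursion (kappa : R) : 0 < kappa ->
  exists K : R, forall f : R -> R, measurable_fun setT f -> (forall x, 0 <= f x <= 1) ->
    (forall x, x \in I -> f x * kappa <= f x * h x) ->
    forall k, `|survival f k.+1 - (1 - escape_rate f) * survival f k|
      <= K * escape_rate f ^+ 2.
Proof.
move=> kappa0; have [K1 K10 bvK] := markov_bv hTM hf.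
have [K2 K20 gap] := spectral_gap_perturbation hTM hf.
have dh := dominated_density hf.
have [H hH] := dominated_bounded hTM hf dh.
have G0 := Gamma_gt0 hTM.
have H0 : 0 <= H.
  apply: le_trans (hH 1 _); first exact: normr_ge0.
  by rewrite phase_spaceE; apply/andP; split; lra.
(* K2 * K1 * delta bounds the distance to the line of h; the normalisation by
   the survival mass adds the length of the phase space times sup h *)
pose K3 := K2 * K1 * (1 + (1 + Gamma S) * H).
exists (K3 / kappa) => f mf f01 fkappa k.
set delta := escape_rate f.
have d0 j := survivor_dominated mf f01 j.
have d1 j := dominatedM mf f01 (d0 j).
have dfh := dominatedM mf f01 dh.
have delta0 : 0 <= delta.
  by apply: Rintegral_ge0 => x _; have [_ /(_ x)/andP[]] := dfh.
have e0 : 0 <= K1 * delta by exact: mulr_ge0.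
have bdd g : dominated h g -> bounded_on_phase S g.
  exact: (dominated_bounded hTM hf).
pose w j : R -> R := L (fun x => f x * survivor f j x).
have we j : (bv_norm S (w j) <= (K1 * delta)%:E)%E.
  have [m1 h1] := d1 j.
  apply: (le_trans (bvK _ m1 (bdd _ (d1 j)) _)).
    by move=> x; have /andP[] := h1 x.
  rewrite lee_fin ler_wpM2l//; apply: Rintegral_mono => //.
  - exact: bdd.
  - by case: dfh.
  - exact: bdd.
  - move=> x _; apply: ler_wpM2l; first by have /andP[] := f01 x.
    by have [_ /(_ x)/andP[]] := d0 j.
have [a ak] := gap w (survivor f)
  (K1 * delta) e0 erefl (survivor_BV mf f01)
  (fun j => markov_dominated_BV (d1 j)) we (survivor_step mf f01) k.
set s := survivor f k in ak *; have [ms hs] := d0 k.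
rewrite -/s in ms hs.
have bs : bounded_on_phase S s by exact: bdd (d0 k).
have [mh hh] := dh; have bh := bdd _ dh.
have mdiff b : measurable_fun setT (fun x => - b * h x + s x).
  by apply: measurable_funD => //; apply: measurable_funM.
have Sa : `|survival f k - a| <= K2 * (K1 * delta) * (1 + Gamma S).
  rewrite (_ : survival f k - a =
      \int[leb]_(x in I) (- a * h x + s x)).
    apply: Rintegral_bound => // x xI.
    by rewrite mulNr addrC; exact: ak.
  rewrite Rintegral_lin// -/(survival f k).
  rewrite (_ : \int[leb]_(x in I) h x = 1); last first.
    by rewrite /Rintegral (density_mass hTM hf).
  by rewrite mulr1 addrC.
have sS x : x \in I -> `|- survival f k * h x + s x| <= K3 * delta.
  move=> xI.
  have -> : - survival f k * h x + s x =
    (s x - a * h x) + (a - survival f k) * h x by ring.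
  apply: (le_trans (ler_normD _ _)).
  rewrite /K3 -mulrA (mulrC _ delta) mulrA mulrDr mulr1 -mulrA.
  apply: lerD; first exact: ak.
  rewrite normrM distrC mulrA; apply: ler_pM => //; exact: hH.
have bf : bounded_on_phase S f.
  by exists 1 => x _; have /andP[f0 f1] := f01 x; rewrite ger0_norm.
have intf : \int[leb]_(x in I) f x <= delta / kappa.
  rewrite ler_pdivlMr// mulrC -(RintegralZl kappa (phase_space_measurable S)
    (bounded_integrable hTM mf bf)).
  apply: Rintegral_mono.
  - exact: measurable_funM.
  - exists kappa => x _; have /andP[f0 f1] := f01 x.
    by rewrite normrM !ger0_norm ?(ltW kappa0)// ler_piMr// ltW.
  - by case: dfh.
  - exact: bdd.
  - by move=> x xI; rewrite mulrC; exact: fkappa.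
rewrite survivalS// -/s.
have -> : survival f k - \int[leb]_(x in I) (f x * s x) -
    (1 - delta) * survival f k =
    - \int[leb]_(x in I) (f x * (- survival f k * h x + s x)).
  rewrite [in RHS](_ : \int[leb]_(x in I) _ =
    \int[leb]_(x in I) (- survival f k * (f x * h x) + f x * s x)); last first.
    by apply: eq_Rintegral => x _; ring.
  rewrite Rintegral_lin; first by rewrite -/(escape_rate f) -/delta; ring.
  - by case: dfh.
  - exact: bdd.
  - by case: (d1 k).
  - exact: bdd (d1 k).
rewrite normrN.
have mprod : measurable_fun setT (fun x => f x * (- survival f k * h x + s x)).
  exact: measurable_funM.
have bprod : bounded_on_phase S (fun x => f x * (- survival f k * h x + s x)).
  exists (K3 * delta) => x xI; have /andP[f0 f1] := f01 x.
  by rewrite normrM (ger0_norm f0); apply: le_trans (sS x xI); rewrite ler_piMl.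
have babs : bounded_on_phase S (fun x => `|f x * (- survival f k * h x + s x)|).
  by have [c hc] := bprod; exists c => x xI; rewrite normr_id hc.
apply: (le_trans (le_normr_Rintegral (phase_space_measurable S)
  (bounded_integrable hTM mprod bprod))).
apply: (@le_trans _ _ (\int[leb]_(x in I) (K3 * delta * f x))).
  apply: Rintegral_mono => //.
  - exact: measurableT_comp.
  - exact: measurable_funM.
  - have [c hc] := bf; exists (`|K3 * delta| * c) => x xI.
    by rewrite normrM ler_wpM2l// hc.
  - move=> x xI; have /andP[f0 f1] := f01 x.
    by rewrite normrM (ger0_norm f0) mulrC ler_wpM2r// sS.
rewrite (RintegralZl _ (phase_space_measurable S) (bounded_integrable hTM mf bf)).
have K30 : 0 <= K3 * delta.
  rewrite mulr_ge0// /K3 !mulr_ge0// addr_ge0// mulr_ge0// addr_ge0// ltW//.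
apply: (le_trans (ler_wpM2l K30 intf)).
by rewrite le_eqVlt; apply/orP; left; apply/eqP; ring.
Qed.

End Survival.

(** * Independence of the past from finitely many future noises *)

Section Cylinders.
Context {R : realType} (d : measure_display) (Om : measurableType d)
  (P : probability Om R) (J : eqType) (V : J -> {RV P >-> R}).

Definition cylinder (t : seq J) (A : J -> set R) : set Om :=
  \bigcap_(k in [set` t]) V k @^-1` A k.

Lemma cylinder_nil A : cylinder [::] A = setT.
Proof. by rewrite /cylinder set_nil bigcap_set0. Qed.

Lemma cylinder_cons j t A : cylinder (j :: t) A = V j @^-1` A j `&` cylinder t A.
Proof.
apply/seteqP; split => [z zA | z [zj zt] k /=].
  split; first by apply: zA; rewrite /= mem_head.
  by move=> k /= kt; apply: zA; rewrite /= in_cons kt orbT.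
by rewrite in_cons => /orP[/eqP -> //|kt]; exact: zt.
Qed.

Lemma cylinder_measurable t A : (forall k, measurable (A k)) ->
  measurable (cylinder t A).
Proof.
move=> mA; elim: t => [|j t IH]; first by rewrite cylinder_nil.
rewrite cylinder_cons; apply: measurableI => //.
by rewrite -[X in measurable X]setTI; apply: measurable_funP.
Qed.

Definition set_at (j : J) (B : set R) (A : J -> set R) k :=
  if k == j then B else A k.

Lemma cylinder_set_at j B t A : j \notin t ->
  cylinder (j :: t) (set_at j B A) = V j @^-1` B `&` cylinder t A.
Proof.
move=> jt; rewrite cylinder_cons /set_at eqxx; congr (_ `&` _).
apply: eq_bigcapr => k /= kt; case: eqVneq => // kj.
by rewrite -kj kt in jt.
Qed.

(** Q is an event of the past and w the density of the state X on Q; the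
    identity also says that all of this is independent of the variables with
    index in F.  Carrying the cylinders through the induction replaces a
    discussion of the sigma-algebras generated by the past. *)
Definition splits_off (F : pred J) (Q : set Om) (X : Om -> R) (w : R -> \bar R) :=
  forall t A B, uniq t -> all F t -> (forall k, measurable (A k)) ->
    measurable B ->
    P (Q `&` X @^-1` B `&` cylinder t A) =
      (\int[lebesgue_measure]_(x in B) w x * P (cylinder t A))%E.

(** Conditioning on a cylinder only multiplies the density by a constant, so
    [joint_law_with_density] applies to the past restricted to the cylinder,
    the variable j being adjoined to the cylinder to check it on rectangles. *)
Lemma splits_off_step (F : pred J) Q (X : Om -> R) w j
    (lam : probability (measurableTypeR R) R) t A (D : set (R * R)) :
  mutually_independent V -> measurable Q -> measurable_fun setT X ->
  measurable_fun setT w -> (forall x, (0 <= w x)%E) ->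
  splits_off F Q X w -> F j -> has_law (V j) lam ->
  uniq t -> all F t -> j \notin t -> (forall k, measurable (A k)) ->
  measurable D ->
  P (Q `&` [set z | D (X z, V j z)] `&` cylinder t A) =
    (\int[lebesgue_measure]_x (w x * lam (xsection D x)) * P (cylinder t A))%E.
Proof.
move=> ind mQ mX mw w0 split Fj lawj ut Ft jt mA mD.
have mC := cylinder_measurable t mA.
set c := P (cylinder t A).
have cE : c = (fine c)%:E by rewrite fineK// fin_num_measure.
have mwc : measurable_fun setT (fun x => (w x * c)%E).
  by apply: emeasurable_funM => //; exact: measurable_cst.
have wc0 x : (0 <= w x * c)%E by rewrite mule_ge0// measure_ge0.
have mQC : measurable (Q `&` cylinder t A) by exact: measurableI.
have -> : Q `&` [set z | D (X z, V j z)] `&` cylinder t A =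
  (Q `&` cylinder t A) `&` [set z | D (X z, V j z)] by rewrite setIAC.
have mV : measurable_fun setT (V j) by exact: measurable_funP.
rewrite (joint_law_with_density (lam := lam) mQC mX mV mwc wc0 _ mD) //; first last.
- move=> B C mB mC'.
  have -> : Q `&` cylinder t A `&` X @^-1` B `&` V j @^-1` C =
      Q `&` X @^-1` B `&` cylinder (j :: t) (set_at j C A).
    by rewrite cylinder_set_at//; apply/seteqP; split => z /=; tauto.
  have mS k : measurable (set_at j C A k) by rewrite /set_at; case: ifP.
  apply: etrans (split (j :: t) (set_at j C A) B _ _ mS mB) _.
  + by rewrite /= jt.
  + by rewrite /= Fj.
  rewrite cylinder_set_at//.
  have -> : P (V j @^-1` C `&` cylinder t A) = (lam C * c)%E.
    rewrite -cylinder_set_at// /cylinder ind//=; last by rewrite jt.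
    rewrite big_cons /set_at eqxx -(lawj C mC') /distribution /pushforward.
    congr (_ * _)%E; rewrite /c /cylinder ind//.
    by apply: eq_big_seq => k kt; case: eqVneq => // kj; rewrite -kj kt in jt.
  rewrite ge0_integralZr ?measure_ge0//; last exact: measurable_funTS.
  by rewrite muleA muleAC.
rewrite -ge0_integralZr ?measure_ge0//.
- by apply: eq_integral => x _; rewrite muleAC.
- apply: emeasurable_funM => //.
  exact: (measurable_fun_xsection lam mD).
- by move=> x _; rewrite mule_ge0// measure_ge0.
Qed.

End Cylinders.

(** * Law of the surviving state *)

Section ObservedChain.
Context {R : realType} (S : system R) (hTM : assumption_TM S).
Local Notation leb := (@lebesgue_measure R).
Local Notation I := (phase_space S).
Local Notation L := (markov_op S).
Variables (mu : probability (measurableTypeR R) R) (h : R -> R).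
Hypothesis hf : standing_facts S mu h.
Variable psi : probability (measurableTypeR R) R.
Context (d : measure_display) (Om : measurableType d) (P : probability Om R).
Variables (X0 : {RV P >-> R}) (eta eps : nat -> {RV P >-> R}).
Hypothesis hprod : product_setting S X0 eta eps mu psi.

Local Notation V := (all_variables X0 eta eps).

(** The noise seen with values in the Borel measurable type, on which
    Lebesgue measure lives. *)
Definition borel_eta (z : Om) : measurableTypeR R := eta 0%N z.

Lemma borel_eta_measurable : measurable_fun setT borel_eta.
Proof. exact: (measurable_funP (eta 0%N)). Qed.

HB.instance Definition _ :=
  isMeasurableFun.Build _ _ _ _ borel_eta borel_eta_measurable.

Definition dynamical_law : probability (measurableTypeR R) R :=
  distribution P borel_eta.

Lemma dynamical_lawE A : measurable A -> dynamical_law A = noise_law S A.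
Proof. exact: (ps_eta hprod 0%N). Qed.

(** The two thresholds differ by one between the observation at a time and
    the next move, since the observational noise is consumed first. *)
Definition future (a b : nat) (j : option (nat + nat)) : bool :=
  match j with
  | None => false
  | Some (inl i) => (a <= i)%N
  | Some (inr i) => (b <= i)%N
  end.

Definition state (k : nat) (z : Om) : R := Defs.orbit S (fun i => eta i z) k (X0 z).

Lemma state_measurable k : measurable_fun setT (state k).
Proof.
elim: k => [|k IH]; first exact: measurable_funP.
have mp : measurable_fun setT (fun z => (state k z, eta k z)).
  by apply: measurable_fun_pair => //; exact: measurable_funP.
exact: (measurableT_comp (T_noise_measurable hTM) mp).
Qed.

Variable K : set R.
Hypothesis mK : measurable K.

Fixpoint survives (k : nat) : set Om :=
  if k is k'.+1 then
    survives k' `&` [set z | K (observed S X0 eta eps k' z)]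
  else setT.

Lemma survives_measurable k : measurable (survives k).
Proof.
elim: k => [|k IH] /=; first exact: measurableT.
apply: measurableI => //.
have mo : measurable_fun setT (observed S X0 eta eps k).
  by apply: measurable_funD; [exact: state_measurable|exact: measurable_funP].
by have := mo measurableT K mK; rewrite setTI.
Qed.

Variable f : R -> R.
Hypotheses (mf : measurable_fun setT f) (f01 : forall x, 0 <= f x <= 1).
Hypothesis Kf : forall x, h x != 0 -> psi [set e | K (x + e)] = (1 - f x)%:E.
Local Notation surv := (survivor S h f).
Local Notation thinned k := (fun x => (1 - f x) * surv k x).

Lemma dominated_outside g x : dominated h g -> h x = 0 -> g x = 0.
Proof.
move=> [_ /(_ x)]; move=> + hx0; rewrite hx0 => g0.
by apply/eqP; rewrite eq_le andbC.
Qed.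

Lemma thinned_dominated k : dominated h (thinned k).
Proof.
apply: (dominatedM (escape_compl_measurable mf) (escape_compl_bounds f01)).
exact: (survivor_dominated hTM hf).
Qed.

Lemma dominated_weight_measurable g : dominated h g ->
  measurable_fun setT (fun x => (g x)%:E).
Proof. by move=> [mg _]; exact/measurable_EFinP. Qed.

Lemma dominated_weight_ge0 g : dominated h g -> forall x, (0 <= (g x)%:E)%E.
Proof. by move=> [_ gh] x; rewrite lee_fin; have /andP[] := gh x. Qed.

Lemma splits_initial :
  splits_off V (future 0 0) setT (state 0) (fun x => (h x)%:E).
Proof.
move=> t A B ut Ft mA mB.
have Nt : None \notin t by apply/negP => /(allP Ft).
have ind := ps_indep hprod.
rewrite setTI -(@cylinder_set_at _ _ _ P _ V None)// /cylinder ind//=; last 2 first.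
- by rewrite Nt.
- by move=> k; rewrite /set_at; case: ifP.
rewrite big_cons /set_at eqxx; congr (_ * _)%E.
  rewrite -(sf_density hf)//; exact: (ps_initial hprod).
rewrite ind//; apply: eq_big_seq => k kt.
by case: eqVneq => // kj; rewrite -kj kt in Nt.
Qed.

(** Given the state x, the observation at time k survives with probability
    [1 - f x]; observing consumes the noise [eps k]. *)
Lemma splits_observe k :
  splits_off V (future k k) (survives k) (state k) (fun x => (surv k x)%:E) ->
  splits_off V (future k k.+1) (survives k.+1) (state k)
    (fun x => (thinned k x)%:E).
Proof.
move=> split t A B ut Ft mA mB.
have sd := survivor_dominated hTM hf mf f01 k.
pose D : set (R * R) := [set q | B q.1 /\ K (q.1 + q.2)].
have mD : measurable D.
  have m1 : measurable [set q : R * R | B q.1].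
    by have := @measurable_fst _ _ R R measurableT B mB; rewrite setTI.
  have m2 : measurable [set q : R * R | K (q.1 + q.2)].
    have ms : measurable_fun setT (fun q : R * R => q.1 + q.2).
      by apply: measurable_funD; [exact: measurable_fst|exact: measurable_snd].
    by have := ms measurableT K mK; rewrite setTI.
  exact: measurableI m1 m2.
have Ft' : all (future k k) t.
  apply: sub_all Ft => -[[i|i]|] //=; exact: ltnW.
have kt : Some (inr k) \notin t.
  by apply/negP => /(allP Ft) /=; rewrite ltnn.
rewrite (_ : _ `&` _ = survives k `&`
    [set z | D (state k z, V (Some (inr k)) z)] `&` cylinder V t A); last first.
  by apply/seteqP; split => z /=; rewrite /D /observed -/(state k z) /=; tauto.
rewrite (splits_off_step (lam := psi) (ps_indep hprod) (survives_measurable k)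
  (state_measurable k) (dominated_weight_measurable sd)
  (dominated_weight_ge0 sd) split)//.
- congr (_ * _)%E; rewrite [RHS]integral_mkcond; apply: eq_integral => x _.
  rewrite /patch; case: ifPn => xB; last first.
    rewrite (_ : xsection D x = set0) ?measure0 ?mule0//.
    apply/seteqP; split => e //; rewrite /xsection /= inE => -[/= Bx _].
    by move: xB; rewrite notin_setE.
  have [hx|hx] := eqVneq (h x) 0.
    by rewrite (dominated_outside sd hx) mul0e mulr0.
  rewrite (_ : xsection D x = [set e | K (x + e)]) ?Kf// -?EFinM 1?mulrC//.
  apply/seteqP; split => e; rewrite /xsection /= inE /D /=; first by case.
  by move=> Ke; split => //; move: xB; rewrite inE.
- by rewrite /=.
- exact: (ps_eps hprod).
Qed.

(** A step of the chain applies the Markov operator to the density and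
    consumes the noise [eta k]. *)
Lemma splits_move k :
  splits_off V (future k k.+1) (survives k.+1) (state k)
    (fun x => (thinned k x)%:E) ->
  splits_off V (future k.+1 k.+1) (survives k.+1) (state k.+1)
    (fun x => (surv k.+1 x)%:E).
Proof.
move=> split t A B ut Ft mA mB.
have td := thinned_dominated k.
pose D : set (R * R) := [set q | B (T_noise S q.2 q.1)].
have mD : measurable D.
  by have := T_noise_measurable hTM measurableT mB; rewrite setTI.
have Ft' : all (future k k.+1) t.
  by apply: sub_all Ft => -[[i|i]|] //=; exact: ltnW.
have kt : Some (inl k) \notin t.
  by apply/negP => /(allP Ft) /=; rewrite ltnn.
rewrite (_ : _ `&` state k.+1 @^-1` B = survives k.+1 `&`
    [set z | D (state k z, V (Some (inl k)) z)])//.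
rewrite (splits_off_step (lam := dynamical_law) (ps_indep hprod)
  (survives_measurable k.+1)
  (state_measurable k) (dominated_weight_measurable td)
  (dominated_weight_ge0 td) split)//.
- congr (_ * _)%E.
  transitivity (\int[leb]_(x in I) ((thinned k x)%:E *
      landing S dynamical_law B x))%E.
    rewrite [RHS]integral_mkcond; apply: eq_integral => x _.
    rewrite /patch; case: ifPn => xI.
      congr (_ * dynamical_law _)%E.
      by apply/seteqP; split => y; rewrite /xsection /= inE.
    by rewrite (dominated_outside td) ?mul0e// (density_zero hTM hf).
  rewrite -(markov_landing hTM hf dynamical_lawE td mB).
  rewrite integral_mkcond [RHS]integral_mkcond; apply: eq_integral => x _.
  rewrite /patch in_setI /= indicE; case: (x \in B) => //=.
  by case: (x \in I) => /=; rewrite ?mul1r ?mul0r.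
- by rewrite /= leqnn.
- by move=> C mC; rewrite (ps_eta hprod k)// dynamical_lawE.
Qed.

Lemma splits_survivor k :
  splits_off V (future k k) (survives k) (state k) (fun x => (surv k x)%:E).
Proof.
elim: k => [|k IH]; first exact: splits_initial.
by apply: splits_move; exact: splits_observe.
Qed.

Lemma survives_probability k : P (survives k) = (survival S h f k)%:E.
Proof.
have sd := survivor_dominated hTM hf mf f01 k.
have := @splits_survivor k [::] (fun=> setT) setT isT isT
  (fun=> measurableT) measurableT.
rewrite cylinder_nil preimage_setT !setIT probability_setT mule1 => ->.
rewrite /survival (dominated_Rintegral hTM hf sd) [RHS]integral_mkcond.
apply: eq_integral => x _; rewrite /patch; case: ifPn => // xI.
by rewrite (dominated_outside sd)// (density_zero hTM hf).
Qed.

End ObservedChain.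

(** * Exceedance sets and the limit law *)

Section Support.
Context {R : realType} (nu : probability (measurableTypeR R) R).

(** The points outside the support are covered by the countably many null
    intervals with rational endpoints. *)
Lemma msupport_full (B : set R) : measurable B -> (0 < nu B)%E ->
  exists2 e, msupport nu e & B e.
Proof.
move=> mB; apply: contraPP => noe; apply/negP; rewrite -leNgt.
pose F (n : nat) : set R := match unpickle n with
  | Some (a, b) => if nu `]ratr a, ratr b[%classic == 0%E
                   then `]ratr a, ratr b[%classic else set0
  | None => set0 end : set R.
have mF n : @measurable _ (measurableTypeR R) (F n).
  rewrite /F; case: unpickle => [[a b]|]; last exact: measurable0.
  by case: ifP => _; [exact: measurable_itv|exact: measurable0].
have F0 n : nu (F n) = 0%E.
  rewrite /F; case: unpickle => [[a b]|]; last exact: measure0.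
  by case: ifP => [/eqP ->|_] //; exact: measure0.
have BF : B `<=` \bigcup_n F n.
  move=> e Be.
  have : ~ msupport nu e by move=> se; apply: noe; exists e.
  move=> /existsNP[U /not_implyP[oU /not_implyP[Ue /negP]]].
  rewrite -leNgt => nuU.
  have [r /= r0 rU] := (nbhs_ballP _ _).1 (open_nbhs_nbhs (conj oU Ue)).
  have [a] := @rat_in_itvoo R (e - r) e ltac:(lra).
  rewrite in_itv /= => /andP[a1 a2].
  have [b] := @rat_in_itvoo R e (e + r) ltac:(lra).
  rewrite in_itv /= => /andP[b1 b2].
  have abU : `]ratr a, ratr b[%classic `<=` U.
    move=> y /=; rewrite in_itv /= => /andP[y1 y2]; apply: rU.
    by rewrite /ball /= ltr_norml; apply/andP; split; lra.
  exists (pickle (a, b)); first exact: Logic.I.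
  rewrite /F pickleK.
  rewrite ifT; first by rewrite /= in_itv /= a2 b1.
  rewrite eq_le measure_ge0 andbT; apply: le_trans nuU.
  apply: le_measure => //; rewrite inE; last exact: open_measurable.
  exact: measurable_itv.
have := measure_sigma_subadditive nu mF mB BF.
rewrite eseries0; last by move=> i *; exact: F0.
exact.
Qed.

Lemma full_set_eq (G A B : set R) : measurable G -> measurable A ->
  measurable B -> nu G = 1%E -> A `&` G = B `&` G -> nu A = nu B.
Proof.
move=> mG mA mB G1 AB.
have nuC : nu (~` G) = 0%E by rewrite probability_setC// G1 subee.
have h C : measurable C -> nu C = nu (C `&` G).
  move=> mC; rewrite -[in LHS](setIT C) -(setUv G) setIUr measureU//.
  - rewrite [X in (_ + X)%E](_ : _ = 0%E) ?adde0//.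
    apply: (subset_measure0 _ _ _ nuC); last exact: subIsetr.
      by apply: measurableI => //; exact: measurableC.
    exact: measurableC.
  - exact: measurableI.
  - by apply: measurableI => //; exact: measurableC.
  - by rewrite setIACA setICr setI0.
by rewrite (h A)// (h B)// AB.
Qed.

End Support.

Section DensityIntegral.
Context {R : realType} (mu psi : probability (measurableTypeR R) R) (h : R -> R).
Hypotheses (mh : measurable_fun setT h) (h0 : forall x, 0 <= h x)
  (muE : forall A, measurable A ->
    mu A = (\int[lebesgue_measure]_(x in A) (h x)%:E)%E).

(** Both sides are the mass of D under the product of mu and psi, computed
    from the definition and from [joint_law_with_density]. *)
Lemma density_integral (D : set (R * R)) : measurable D ->
  (\int[mu]_x psi (xsection D x) =
   \int[lebesgue_measure]_x ((h x)%:E * psi (xsection D x)))%E.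
Proof.
move=> mD.
pose P2 : probability (measurableTypeR R * measurableTypeR R)%type R :=
  (mu \x psi)%E.
have m1 : @measurable_fun _ _ (measurableTypeR R * measurableTypeR R)%type R
  setT fst by exact: measurable_fst.
have m2 : @measurable_fun _ _ (measurableTypeR R * measurableTypeR R)%type R
  setT snd by exact: measurable_snd.
have mw : measurable_fun setT (fun x => (h x)%:E) by exact/measurable_EFinP.
have w0 x : (0 <= (h x)%:E)%E by rewrite lee_fin.
rewrite -(@joint_law_with_density _ _ R P2 setT fst snd measurableT m1 m2 psi
  _ mw w0 _ D mD).
- rewrite setTI (_ : [set o | _] = D)//; apply/seteqP; split => -[]//.
- move=> A B mA mB; rewrite setTI -muE//.
  by rewrite -product_measure1E.
Qed.

End DensityIntegral.

Section Escape.
Context {R : realType} (S : system R) (hTM : assumption_TM S).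
Local Notation leb := (@lebesgue_measure R).
Local Notation I := (phase_space S).
Variables (mu : probability (measurableTypeR R) R) (h : R -> R).
Hypothesis hf : standing_facts S mu h.
Variable psi : probability (measurableTypeR R) R.
Hypothesis hEI : assumption_EI S psi.
Variables (phi : R -> \bar R) (u : nat -> R).
Hypothesis mphi : measurable_fun setT phi.

Definition escape (n : nat) (x : R) : R :=
  fine (psi [set e : R | exceedance S phi u n (x + e)]).

Lemma exceedance_measurable n : measurable (exceedance S phi u n).
Proof.
apply: measurableI; first exact: phase_space_measurable.
by have := emeasurable_fun_o_infty measurableT mphi (u n)%:E; rewrite setTI.
Qed.

Lemma exceedance_pair_measurable n :
  measurable [set q : R * R | exceedance S phi u n (q.1 + q.2)].
Proof.
have ms : measurable_fun setT (fun q : R * R => q.1 + q.2).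
  by apply: measurable_funD; [exact: measurable_fst|exact: measurable_snd].
by have := ms measurableT _ (exceedance_measurable n); rewrite setTI.
Qed.

Lemma exceedance_section n x :
  xsection [set q : R * R | exceedance S phi u n (q.1 + q.2)] x =
  [set e : R | exceedance S phi u n (x + e)].
Proof. by apply/seteqP; split => e; rewrite /xsection /= inE. Qed.

Lemma escapeE n x :
  (escape n x)%:E = psi [set e : R | exceedance S phi u n (x + e)].
Proof.
rewrite fineK// fin_num_measure// -exceedance_section.
exact: measurable_xsection (exceedance_pair_measurable n).
Qed.

Lemma escape_bounds n x : 0 <= escape n x <= 1.
Proof.
rewrite -!lee_fin escapeE measure_ge0 probability_le1//.
rewrite -exceedance_section.
exact: measurable_xsection (exceedance_pair_measurable n).
Qed.

Lemma escape_measurable n : measurable_fun setT (escape n).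
Proof.
apply: (measurableT_comp (fine_measurable measurableT)).
apply: eq_measurable_fun (measurable_fun_xsection psi (exceedance_pair_measurable n)).
by move=> x _ /=; rewrite exceedance_section.
Qed.

Lemma Delta_escape n : Delta S phi u mu psi n = (escape_rate S h (escape n))%:E.
Proof.
rewrite /Delta.
under eq_integral do rewrite -exceedance_section.
rewrite (@density_integral _ mu psi h)//; last 4 first.
- exact: (sf_meas hf).
- exact: (sf_ge0 hf).
- exact: (sf_density hf).
- exact: exceedance_pair_measurable.
rewrite /escape_rate (dominated_Rintegral hTM hf); last first.
  exact: (dominatedM (escape_measurable n) (escape_bounds n) (dominated_density hf)).
rewrite [RHS]integral_mkcond; apply: eq_integral => x _; rewrite /patch.
case: ifPn => xI; last by rewrite (density_zero hTM hf)// mul0e.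
by rewrite exceedance_section EFinM escapeE muleC.
Qed.

(** Almost surely the observation of a point of [I_Gamma] stays in the phase
    space, since the observational noise is smaller than [Gamma / 2]; there
    exceedance is exactly the failure of the threshold inequality. *)
Lemma escape_survival n x : h x != 0 ->
  psi [set e : R | (phi (x + e) <= (u n)%:E)%E] = (1 - escape n x)%:E.
Proof.
move=> hx; have /(I_Gamma_bounds hTM)/andP[x0 x1] := sf_support hf hx.
have [b bG psib] := ei_bounded hEI; have G0 := Gamma_gt0 hTM.
have mx A : measurable A -> @measurable _ (measurableTypeR R) [set e : R | A (x + e)].
  have ms : measurable_fun setT (fun e : R => x + e) by exact: measurable_funD.
  by move=> mA; have := ms measurableT A mA; rewrite setTI.
have mE := mx _ (exceedance_measurable n).
have mK : measurable [set z | (phi z <= (u n)%:E)%E].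
  by have := emeasurable_fun_infty_c measurableT mphi (u n)%:E; rewrite setTI.
have mb : @measurable _ (measurableTypeR R) [set e : R | `|e| <= b].
  rewrite (_ : [set e | _] = `[- b, b]%classic); first exact: measurable_itv.
  by apply/seteqP; split => e /=; rewrite in_itv /= ler_norml.
rewrite (full_set_eq mb (mx _ mK) (measurableC mE) psib).
  by rewrite probability_setC// -escapeE -EFinB.
apply/seteqP; split => e /= [h1 h2]; split => //.
  by move=> [_ /=]; rewrite ltNge h1.
rewrite leNgt; apply/negP => h3; apply: h1; split => //.
have : x + e \in I; last by rewrite inE.
rewrite phase_spaceE.
by move: h2; rewrite ler_norml => /andP[e1 e2]; apply/andP; split; lra.
Qed.

(** If the escape probability at x is positive, some point of the support of
    the noise carries x into the exceedance set. *)
Lemma escape_dominated n kappa x :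
  ((exists2 e, msupport psi e & exceedance S phi u n (x + e)) -> kappa <= h x) ->
  escape n x * kappa <= escape n x * h x.
Proof.
move=> low; have /andP[f0 f1] := escape_bounds n x.
have [->|fn0] := eqVneq (escape n x) 0; first by rewrite !mul0r.
apply: ler_wpM2l => //; apply: low.
apply: (@msupport_full _ psi [set e | exceedance S phi u n (x + e)]).
  rewrite -exceedance_section.
  exact: measurable_xsection (exceedance_pair_measurable n).
by rewrite -escapeE lte_fin lt_neqAle eq_sym fn0.
Qed.

Lemma max_below_survives (d : measure_display) (Om : measurableType d)
    (P : probability Om R) (X0 : {RV P >-> R}) (eta eps : nat -> {RV P >-> R}) v m :
  [set w | (\big[maxe/-oo]_(j < m) phi (observed S X0 eta eps j w) <= v)%E] =
  survives S X0 eta eps [set z | (phi z <= v)%E] m.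
Proof.
elim: m => [|m IH] /=.
  by apply/seteqP; split => w //= _; rewrite big_ord0 leNye.
rewrite -IH; apply/seteqP; split => w /=; rewrite big_ord_recr /= ge_max.
  by move=> /andP.
by move=> ?; apply/andP.
Qed.

End Escape.

Theorem proposition5p3 (R : realType) (S : system R)
    (mu : probability (measurableTypeR R) R) (h : R -> R)
    (psi : probability (measurableTypeR R) R)
    (d : measure_display) (Om : measurableType d) (P : probability Om R)
    (X0 : {RV P >-> R}) (eta eps : nat -> {RV P >-> R})
    (phi : R -> \bar R) (u : nat -> R) (tau : R)
    (hTM : assumption_TM S)
    (hfacts : standing_facts S mu h)
    (hEI : assumption_EI S psi)
    (hprod : product_setting S X0 eta eps mu psi)
    (hB : assumption_B S phi u)
    (hlow : density_bounded_below S phi u h psi)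
    (tau_gt0 : 0 < tau)
    (hDelta : (fun n => (n%:R)%:E * Delta S phi u mu psi n)%E @ \oo --> tau%:E) :
  W phi u P (observed S X0 eta eps) @ \oo --> (expR (- tau))%:E.
Proof.
have [mphi _] := hB; have [kappa k0 low] := hlow.
pose f n := escape S psi phi u n.
have mf n : measurable_fun setT (f n) by exact: escape_measurable.
have f01 n x : 0 <= f n x <= 1 by exact: escape_bounds.
pose delta n := escape_rate S h (f n).
have lamE := dynamical_lawE hprod.
have [K rec] := survival_recursion hTM hfacts lamE k0.
have WE : W phi u P (observed S X0 eta eps) =
    EFin \o (fun n => survival S h (f n) n).
  apply/funext => n; rewrite /W max_below_survives.
  apply: (survives_probability hTM hfacts hprod) => //.
    by have := emeasurable_fun_infty_c measurableT mphi (u n)%:E; rewrite setTI.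
  by move=> x hx; exact: (escape_survival hTM hfacts hEI).
rewrite WE; apply: cvg_EFin; first exact: nearW.
apply: (@cvg_exponential_law _ delta _ (K + 1)).
  have /fine_cvgP[_] := hDelta.
  apply: cvg_trans; apply: near_eq_cvg; near=> n.
  by rewrite /= (Delta_escape hTM hfacts psi u mphi) -EFinM.
move=> n; apply: (@exponential_decay _ (survival S h (f n)) (delta n) K).
- apply: Rintegral_ge0 => x _; apply: mulr_ge0; last exact: (sf_ge0 hfacts).
  by have /andP[] := f01 n x.
- exact: (survival0 hTM hfacts).
- by move=> k; exact: (survival_bound hTM hfacts).
- have fk : forall x, x \in phase_space S -> f n x * kappa <= f n x * h x.
    by move=> x xI; apply: (escape_dominated mphi); exact: low.
  exact: (rec (f n) (mf n) (f01 n) fk).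
Unshelve. all: by end_near. Qed.
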